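(* Let $\mathscr{A}$ be a linear homogeneous constant-coefficient partial differential operator of constant rank on $\mathbb{R}^n$, from $\mathbb{V}$-valued to $\mathbb{W}$-valued fields, with spanning wave cone, $\mathrm{span}\,\Lambda_{\mathscr{A}}=\mathbb{V}$. Let $\mathscr{B}$ be a linear homogeneous constant-coefficient operator of order $l\ge1$ from $\mathbb{U}$-valued to $\mathbb{V}$-valued fields with $\ker\mathscr{A}(\xi)=\mathrm{im}\,\mathscr{B}(\xi)$ for all $\xi\ne0$. Let $z\in\mathbb{V}$, let $\nu^0$ be a probability measure on $\mathbb{V}$, $\nu^\infty$ a probability measure on $\mathbb{S}_{\mathbb{V}}$ and $t>0$, with $(\nu^0,t\nu^\infty)\in Y_z$. Then for every $\mathscr{A}$-quasiconvex $F\in\mathbb{H}$, $$G_F(\overline\nu^\infty)\le\int_{\mathbb{S}_{\mathbb{V}}}F^\infty\,d\nu^\infty,$$ where $G_F(y)=\sup\{F'(z_0)\cdot y:\ z_0\in\mathbb{V},\ F\text{ is differentiable at }z_0\}$.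
   Context: $\mathbb{U},\mathbb{V},\mathbb{W}$ are finite-dimensional real inner product spaces; $\mathbb{S}_{\mathbb{V}}$ is the unit sphere of $\mathbb{V}$. $\mathscr{A}=\sum_{|\alpha|=k}A_\alpha\partial^\alpha$, $A_\alpha\colon\mathbb{V}\to\mathbb{W}$ linear, with symbol $\mathscr{A}(\xi)=\sum_{|\alpha|=k}\xi^\alpha A_\alpha$, and similarly $\mathscr{B}=\sum_{|\beta|=l}B_\beta\partial^\beta$, $\mathscr{B}(\xi)=\sum_{|\beta|=l}\xi^\beta B_\beta$. Constant rank: $\mathrm{rank}\,\mathscr{A}(\xi)$ is independent of $\xi\neq0$. Wave cone: $\Lambda_{\mathscr{A}}=\bigcup_{|\xi|=1}\ker\mathscr{A}(\xi)$. $\mathbb{H}$ is the space of continuous $\Phi\colon\mathbb{V}\to\mathbb{R}$ of linear growth ($|\Phi(z)|\le c(1+|z|)$) for which $\Phi^\infty(z)=\lim_{t\to\infty}\Phi(tz)/t$ exists locally uniformly in $z\in\mathbb{V}$. A continuous $f\colon\mathbb{V}\to\mathbb{R}$ is $\mathscr{A}$-quasiconvex if $f(z)\le\int_{(0,1)^n}f(z+w(x))\,dx$ for all $z\in\mathbb{V}$ and all $(0,1)^n$-periodic $w\in C^\infty(\mathbb{R}^n,\mathbb{V})$ with $\int_{(0,1)^n}w\,dx=0$ and $\mathscr{A}w=0$. (With spanning wave cone, $\mathscr{A}$-quasiconvex functions of linear growth are Lipschitz.) Barycentre: $\overline\nu^\infty=\int_{\mathbb{S}_{\mathbb{V}}}y\,d\nu^\infty(y)$.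 For $z\in\mathbb{V}$, $Y_z$ is the set of pairs $(\mu^0,\mu^\infty)$, with $\mu^0$ a probability measure on $\mathbb{V}$ and $\mu^\infty$ a positive Radon measure on $\mathbb{S}_{\mathbb{V}}$, for which there is a sequence $u_j\in C^\infty_c((0,1)^n,\mathbb{U})$ with $\|u_j\|_{W^{l-1,1}}\to0$ and $\int_{(0,1)^n}\Phi(z+\mathscr{B}u_j(x))\,dx\to\int_{\mathbb{V}}\Phi\,d\mu^0+\int_{\mathbb{S}_{\mathbb{V}}}\Phi^\infty\,d\mu^\infty$ for all $\Phi\in\mathbb{H}$. *)

(* Defs.v *)
From HB Require Import structures.
From mathcomp Require Import all_boot all_order all_algebra.
From mathcomp Require Import all_classical all_reals all_analysis.

Set Implicit Arguments.
Unset Strict Implicit.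
Unset Printing Implicit Defensive.

Import Order.TTheory GRing.Theory Num.Theory.
Import numFieldNormedType.Exports.

Local Open Scope classical_set_scope.
Local Open Scope ring_scope.

(* Finite-dimensional real inner product spaces; the topology is that of the
   norm, which norm_dot forces to be the one of the inner product. *)
HB.mixin Record NormedVector_isInnerProduct (R : realType) V
    & NormedModule R V & Vector R V := {
  dot : V -> V -> R ;
  dotC : forall x y, dot x y = dot y x ;
  dotDl : forall x y z, dot (x + y) z = dot x z + dot y z ;
  dotZl : forall (a : R) x y, dot (a *: x) y = a * dot x y ;
  norm_dot : forall x, `|x| ^+ 2 = dot x x
}.

#[short(type="innerProductType")]
HB.structure Definition InnerProduct (R : realType) :=
  {V of NormedModule R V & Vector R V & NormedVector_isInnerProduct R V}.

Notation borel V := (g_sigma_algebraType (@open V)).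

Definition sphere (R : realType) (V : normedModType R) : set V :=
  [set y | `|y| = 1].

Section lebesgue_cons.
Context (R : realType) (n : nat).
Local Notation mR := (measurableTypeR R).
Variable m : {sigma_finite_measure set (n.-tuple mR) -> \bar R}.

Definition tcons (x : mR * n.-tuple mR) : n.+1.-tuple mR := [tuple of x.1 :: x.2].

Lemma measurable_tcons : measurable_fun setT tcons.
Proof. exact: measurable_cons. Qed.

Let leb : {sigma_finite_measure set mR -> \bar R} := lebesgue_measure.

Definition lebesgue_cons : set (n.+1.-tuple mR) -> \bar R :=
  pushforward (leb \x m)%E tcons.

HB.instance Definition _ := Measure.copy lebesgue_cons
  (measure_function_pushforward__canonical__measure_function_Measure
    (leb \x m)%E measurable_tcons).

Lemma lebesgue_cons_sigma_finite : sigma_finite setT lebesgue_cons.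
Proof.
have /sigma_finiteP[F [FT ndF Ffin]] := sigma_finiteT leb.
have /sigma_finiteP[G [GT ndG Gfin]] := sigma_finiteT m.
pose uncons (t : n.+1.-tuple mR) : mR * n.-tuple mR :=
  (thead t, [tuple of behead t]).
have unconsK x : uncons (tcons x) = x.
  case: x => a t; rewrite /uncons /tcons theadE; congr pair.
  exact: val_inj.
have muncons : measurable_fun setT uncons.
  apply: measurable_fun_pair => /=; first exact: measurable_tnth.
  exact: measurable_behead.
exists (fun k => uncons @^-1` (F k `*` G k)).
  apply/seteqP; split => // t _.
  have [i _ Fi] : (\bigcup_i F i) (uncons t).1 by rewrite -FT.
  have [j _ Gj] : (\bigcup_i G i) (uncons t).2 by rewrite -GT.
  exists (maxn i j) => //; split.
    by move: Fi; apply/subsetPset/ndF/leq_maxl.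
  by move: Gj; apply/subsetPset/ndG/leq_maxr.
move=> k; have [mF Foo] := Ffin k; have [mG Goo] := Gfin k; split.
  by rewrite -[X in measurable X]setTI; apply: muncons => //; exact: measurableX.
rewrite /lebesgue_cons /pushforward -comp_preimage.
have -> : uncons \o tcons = id by apply/funext.
rewrite preimage_id.
by rewrite product_measure1E// lte_mul_pinfty// ge0_fin_numE.
Qed.

HB.instance Definition _ := Measure_isSigmaFinite.Build _ _ _ lebesgue_cons
  lebesgue_cons_sigma_finite.
End lebesgue_cons.

(* Lebesgue measure on R^n, with n-tuples as points: the n-fold product of the
   one-dimensional Lebesgue measure. *)
Fixpoint lebesgue_tuple (R : realType) (n : nat) :
    {sigma_finite_measure set (n.-tuple (measurableTypeR R)) -> \bar R} :=
  if n is n'.+1 then lebesgue_cons (lebesgue_tuple R n')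
  else \d_([tuple]).

Definition cube (R : realType) n : set 'rV[R]_n :=
  [set x | forall i, 0 < x 0 i < 1].

Definition row_of_tuple (R : realType) n (x : n.-tuple (measurableTypeR R)) :
    'rV[R]_n := \row_i tnth x i.

Definition cube_integral (R : realType) n (f : 'rV[R]_n -> R) : R :=
  \int[lebesgue_tuple R n]_(x in @row_of_tuple R n @^-1` @cube R n)
    f (row_of_tuple x).

(* Integrals of V-valued maps, computed coordinatewise in a basis of V; the
   value does not depend on the basis. *)
Definition vector_integral (R : realType) (V : vectType R)
    (integral : (V -> R) -> R) : V :=
  \sum_(i < \dim {:V}) integral (coord (vbasis {:V}) i) *: (vbasis {:V})`_i.

Section operators.
Context (R : realType) (n : nat).

(* Multi-indices with entries at most k; every multi-index of length at most k
   is one of them. *)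
Definition mindex (k : nat) := {ffun 'I_n -> 'I_k.+1}.

Definition mlength k (a : mindex k) : nat := (\sum_i a i)%N.

Definition monomial k (a : mindex k) (xi : 'rV[R]_n) : R :=
  \prod_i xi 0 i ^+ a i.

Definition pderiv (V : normedModType R) (i : 'I_n) (f : 'rV[R]_n -> V) :
    'rV[R]_n -> V :=
  fun x => 'D_(delta_mx 0 i) f x.

Definition mderiv (V : normedModType R) k (a : mindex k) (f : 'rV[R]_n -> V) :
    'rV[R]_n -> V :=
  foldr (fun i g => iter (a i) (pderiv i) g) f (enum 'I_n).

Definition smooth (V : normedModType R) (f : 'rV[R]_n -> V) : Prop :=
  forall (s : seq 'I_n) (x : 'rV[R]_n),
    differentiable (foldr (@pderiv V) f s) x.

Definition smooth_compact_in_cube (V : normedModType R)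
    (f : 'rV[R]_n -> V) : Prop :=
  let supp := closure [set x | f x != 0] in
  [/\ smooth f, compact supp & supp `<=` @cube R n].

Definition sobolev_norm (V : normedModType R) (m : nat)
    (f : 'rV[R]_n -> V) : R :=
  \sum_(a : mindex m | (mlength a <= m)%N)
    cube_integral (fun x => `|mderiv a f x|).

(* Coefficients of a homogeneous operator of order k; those at multi-indices of
   length different from k are never used. *)
Definition operator (V W : vectType R) (k : nat) := mindex k -> 'Hom(V, W).

Definition symbol (V W : vectType R) k (A : operator V W k) (xi : 'rV[R]_n) :
    'Hom(V, W) :=
  \sum_(a : mindex k | mlength a == k) monomial a xi *: A a.

Definition apply_operator (V W : innerProductType R) k (A : operator V W k)
    (f : 'rV[R]_n -> V) (x : 'rV[R]_n) : W :=
  \sum_(a : mindex k | mlength a == k) A a (mderiv a f x).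

Definition constant_rank (V W : vectType R) k (A : operator V W k) : Prop :=
  exists r : nat, forall xi : 'rV[R]_n, xi != 0 -> \dim (limg (symbol A xi)) = r.

(* The norm of 'rV[R]_n is the maximum norm, hence the explicit Euclidean unit
   sphere. *)
Definition wave_cone (V W : vectType R) k (A : operator V W k) : set V :=
  [set v | exists2 xi : 'rV[R]_n,
     \sum_i xi 0 i ^+ 2 = 1 & v \in lker (symbol A xi)].

Definition spanning_wave_cone (V W : vectType R) k (A : operator V W k) : Prop :=
  forall v : V, exists2 ys : seq V,
    (forall y, y \in ys -> wave_cone A y) & v \in <<ys>>%VS.

Definition cube_periodic (V : Type) (w : 'rV[R]_n -> V) : Prop :=
  forall (i : 'I_n) (x : 'rV[R]_n), w (x + delta_mx 0 i) = w x.

Definition quasiconvex (V W : innerProductType R) k (A : operator V W k)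
    (f : V -> R) : Prop :=
  continuous f /\
  forall (z : V) (w : 'rV[R]_n -> V),
    smooth w -> cube_periodic w ->
    vector_integral (fun c => cube_integral (fun x => c (w x))) = 0 ->
    (forall x, apply_operator A w x = 0) ->
    f z <= cube_integral (fun x => f (z + w x)).

End operators.

Section generalized_functions.
Context (R : realType) (V : innerProductType R).

Definition recession (Phi : V -> R) (z : V) : R :=
  lim (Phi (t *: z) / t @[t --> +oo]).

(* Compact convergence is locally uniform convergence, V being locally
   compact. *)
Definition in_H (Phi : V -> R) : Prop :=
  [/\ continuous Phi,
      exists c : R, forall z, `|Phi z| <= c * (1 + `|z|)
    & {family compact,
        (fun z => Phi (t *: z) / t) @[t --> +oo] --> recession Phi}].

(* sup of F'(z0) . y; in the extended reals the supremum always exists. *)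
Definition gradient_sup (F : V -> R) (y : V) : \bar R :=
  ereal_sup [set ('d F z0 y)%:E | z0 in [set z0 : V | differentiable F z0]].

Definition sphere_integral (mu : {measure set (borel V) -> \bar R})
    (f : V -> R) : R :=
  \int[mu]_(y in @sphere R V) f y.

Definition barycentre (mu : {measure set (borel V) -> \bar R}) : V :=
  vector_integral (sphere_integral mu).

(* A positive Radon measure on the (compact) unit sphere is encoded as a finite
   Borel measure on V for which the complement of the sphere is null. The
   integrability of Phi makes explicit that its integral is a real number. *)
Definition in_Y n (U : innerProductType R) l (B : operator n U V l) (z : V)
    (mu0 muoo : {measure set (borel V) -> \bar R}) : Prop :=
  [/\ mu0 setT = 1%E, (muoo setT < +oo)%E, muoo (~` @sphere R V) = 0%E
    & exists u : nat -> 'rV[R]_n -> U,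
      [/\ forall j, smooth_compact_in_cube (u j),
          sobolev_norm l.-1 (u j) @[j --> \oo] --> 0
        & forall Phi : V -> R, in_H Phi ->
            mu0.-integrable setT (EFin \o Phi) /\
            cube_integral (fun x => Phi (z + apply_operator B (u j) x))
              @[j --> \oo] -->
            \int[mu0]_y Phi y + sphere_integral muoo (recession Phi)]].

End generalized_functions.

(* Main.v *)
Require Import Defs.
From HB Require Import structures.
From mathcomp Require Import all_boot all_order all_algebra.
From mathcomp Require Import ring lra zify.
From mathcomp Require Import all_classical all_reals all_analysis measurable_realfun.

Set Implicit Arguments.
Unset Strict Implicit.
Unset Printing Implicit Defensive.

Import Order.TTheory GRing.Theory Num.Theory.
Import numFieldNormedType.Exports.

Local Open Scope classical_set_scope.
Local Open Scope ring_scope.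

(** For [a > 0] the function [F_a(y) = (F(z0 + a (y - z)) - F(z0)) / a] is
    again quasiconvex, lies in [H], vanishes at [z] and has the recession
    function of [F].  Testing quasiconvexity with the periodic extension of
    [B u_j], which is admissible because [A B = 0] and [B u_j] has mean zero,
    and letting [j] tend to infinity gives
    [0 <= \int F_a dnu0 + t \int F^oo dnuoo].
    As [a] tends to [0], [F_a(y)] converges to [F'(z0) (y - z)] and is dominated
    by [M |y - z|].  Finally [z - \int y dnu0 = t \int y dnuoo], by testing the
    convergence in [Y_z] with linear functions. *)

(** * Linear maps on inner product spaces *)

(** The concentration term does not depend on [a], so letting [a] tend to [0] linearises [F] on the
    oscillation part alone. In [F_a (z + B u_j)] the point [z] cancels, which leaves
    [(F (z0 + a B u_j) - F z0) / a]; the factor [a] is absorbed into the potential [a u_j], so it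
    suffices to test [F] itself at [z0]. The dominating constant joins two regimes:
    differentiability at [z0] for small increments, linear growth for large ones. The obstacle is
    [A B = 0]. The hypothesis gives it for symbols, frequency by frequency, whereas fields need the
    total coefficient of each derivative to vanish. These coefficients are recovered by evaluating
    the symbols along a curve on which distinct monomials become distinct powers of one variable;
    Schwarz's theorem then collects the derivatives that belong to one multi-index. *)

Section inner_product.
Context (R : realType) (V : innerProductType R).
Implicit Types x y : V.

Lemma dotDr x y z : dot x (y + z) = dot x y + dot x z.
Proof. by rewrite dotC dotDl !(dotC _ x). Qed.

Lemma dotZr (a : R) x y : dot x (a *: y) = a * dot x y.
Proof. by rewrite dotC dotZl dotC. Qed.

Lemma dot0l y : dot 0 y = 0.
Proof. by rewrite -(scale0r 0) dotZl mul0r. Qed.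

Lemma dot_suml I (r : seq I) (F : I -> V) y :
  dot (\sum_(i <- r) F i) y = \sum_(i <- r) dot (F i) y.
Proof.
elim: r => [|i r IH]; first by rewrite !big_nil dot0l.
by rewrite !big_cons dotDl IH.
Qed.

Lemma dot_sumr I (r : seq I) (F : I -> V) y :
  dot y (\sum_(i <- r) F i) = \sum_(i <- r) dot y (F i).
Proof. by rewrite dotC dot_suml; apply: eq_bigr => i _; rewrite dotC. Qed.

Lemma cauchy_schwarz x y : `|dot x y| <= `|x| * `|y|.
Proof.
rewrite -(@ler_pXn2r _ 2) ?nnegrE ?mulr_ge0// exprMn !norm_dot real_normK ?num_real//.
have [->|y0] := eqVneq y 0; first by rewrite dotC !dot0l expr0n mulr0.
have yy : 0 < dot y y by rewrite -norm_dot exprn_gt0// normr_gt0.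
rewrite -(ler_pM2l yy).
(* The vector is [dot y y] times the component of [x] orthogonal to [y]; its squared norm is [dot y
   y * (dot x x * dot y y - dot x y ^+ 2)]. *)
have : 0 <= dot (dot y y *: x - dot x y *: y) (dot y y *: x - dot x y *: y).
  by rewrite -norm_dot exprn_ge0.
rewrite -!scaleNr !(dotDl, dotDr, dotZl, dotZr) (dotC y x).
lra.
Qed.

(* The Gram matrix of a basis is invertible, so the coordinates are linear
   combinations of inner products with the basis vectors. *)
Lemma coord_dot : exists c : 'I_(\dim {:V}) -> V, forall i v,
  coord (vbasis {:V}) i v = dot v (c i).
Proof.
set d := \dim {:V}; pose b (i : 'I_d) : V := (vbasis {:V})`_i.
have vE v : v = \sum_i coord (vbasis {:V}) i v *: b i.
  by rewrite -coord_vbasis ?memvf.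
pose G : 'M[R]_d := \matrix_(i, j) dot (b i) (b j).
have uG : G \in unitmx.
  (* A row in the kernel of [G] gives a combination of the basis that is orthogonal to every basis
     vector, hence to itself. *)
  rewrite -row_free_unit; apply: inj_row_free => u uG0.
  have dotuE j : dot (\sum_i u 0 i *: b i) (b j) = 0.
    have := congr1 (fun w : 'rV_d => w 0 j) uG0; rewrite !mxE dot_suml; apply: etrans.
    by apply: eq_bigr => i _; rewrite dotZl mxE.
  have : dot (\sum_i u 0 i *: b i) (\sum_i u 0 i *: b i) = 0.
    by rewrite dot_sumr big1// => i _; rewrite dotZr dotuE mulr0.
  rewrite -norm_dot => /eqP; rewrite expf_eq0/= normr_eq0 => /eqP s0.
  have /freeP := basis_free (vbasisP {:V}).
  move=> /(_ (u 0) s0) u0.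
  by apply/rowP => i; rewrite u0 mxE.
exists (fun i => \sum_j invmx G j i *: b j) => i v.
pose c : 'rV[R]_d := \row_k coord (vbasis {:V}) k v.
have -> : coord (vbasis {:V}) i v = (c *m G *m invmx G) 0 i by rewrite mulmxK// mxE.
rewrite mxE dot_sumr; apply: eq_bigr => j _.
rewrite dotZr mulrC; congr (_ * _).
rewrite mxE {1}(vE v) dot_suml; apply: eq_bigr => k _.
by rewrite dotZl !mxE.
Qed.

(** Coordinates are inner products with fixed vectors, so the Cauchy-Schwarz inequality bounds each
    of them by a multiple of the norm. *)
Lemma linear_findim_continuous (W : normedModType R) (f : {linear V -> W}) :
  continuous f.
Proof.
have [c cE] := coord_dot.
apply: bounded_linear_continuous; apply/linear_boundedP.
set M := \sum_i `|c i| * `|f (vbasis {:V})`_i|.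
exists M; split; first exact: num_real.
move=> r Mr x; rewrite {1}(coord_vbasis (memvf x)) linear_sum.
apply: (le_trans (ler_norm_sum _ _ _)).
apply: le_trans (ler_wpM2r (normr_ge0 x) (ltW Mr)).
rewrite mulr_suml; apply: ler_sum => i _.
rewrite linearZ normrZ cE mulrAC ler_wpM2r// mulrC.
exact: cauchy_schwarz.
Qed.

Lemma basis_coord_continuous i : continuous (coord (vbasis {:V}) i : V -> R).
Proof. exact: (@linear_findim_continuous R^o). Qed.

End inner_product.

(** * Iterated partial derivatives *)

Section line.
Context (R : realType) (E F : normedModType R).

Lemma is_derive_line (f : E -> F) (x v : E) (s : R) :
  derivable f (x + s *: v) v ->
  is_derive s 1 (fun s : R => f (x + s *: v)) ('D_v f (x + s *: v)).
Proof.
have e : (fun h => h^-1 *: (f (x + (h *: (1 : R) + s) *: v) - f (x + s *: v)))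
   = (fun h => h^-1 *: (f (h *: v + (x + s *: v)) - f (x + s *: v))).
  apply/funext => h; congr (_ *: (f _ - _)).
  by rewrite scalerDl addrCA -[h *: 1]/(h * 1) mulr1.
move=> df; split; first by rewrite /derivable e.
by rewrite /derive e.
Qed.

Lemma derive_comp_linear (G : normedModType R) (L : {linear F -> G}) (f : E -> F) x v :
  continuous L -> derivable f x v -> 'D_v (L \o f) x = L ('D_v f x).
Proof.
move=> cL df; rewrite /derive.
have -> : (fun h : R => h^-1 *: ((L \o f \o shift x) (h *: v) - (L \o f) x)) =
   L \o (fun h => h^-1 *: ((f \o shift x) (h *: v) - f x)).
  by apply/funext => h /=; rewrite -linearB -linearZ.
by apply/cvg_lim => //; apply: continuous_cvg => //; exact: cL.
Qed.

End line.

Section iterated.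
Context (R : realType) (n : nat).
Local Notation D s f := (foldr (@pderiv R n _) f s).

Section one.
Context (V : normedModType R).
Implicit Types (f g : 'rV[R]_n -> V).

Lemma smooth_iterated f s : smooth f -> smooth (D s f).
Proof. by move=> sf t x; rewrite -foldr_cat; exact: sf. Qed.

Lemma smooth_differentiable f x : smooth f -> differentiable f x.
Proof. by move=> /(_ [::]); exact. Qed.

Lemma smooth_continuous f : smooth f -> continuous f.
Proof. by move=> sf x; apply: differentiable_continuous; exact: smooth_differentiable. Qed.

Lemma smooth_derivable f x v : smooth f -> derivable f x v.
Proof. by move=> sf; apply: diff_derivable; exact: smooth_differentiable. Qed.

(** A derivative depends only on the germ of the function; [near_join] keeps the equality on a
    neighbourhood, ready for the next derivative. *)
Lemma iterated_near f g s (x : 'rV[R]_n) : (\forall y \near x, f y = g y) ->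
  \forall y \near nbhs (x : 'rV[R]_n), D s f y = D s g y.
Proof.
elim: s => [//|i s IH] fg /=.
have : \forall y \near x, \forall z \near nbhs (y : 'rV[R]_n), D s f z = D s g z.
  by apply: near_join; exact: IH.
apply: filterS => y fgy; apply: near_eq_derive => //.
Qed.

Lemma iterated_translate f (m : 'rV[R]_n) s :
  D s (fun x => f (x - m)) = (fun x => D s f (x - m)).
Proof.
elim: s => [//|i s /= ->]; apply/funext => x; rewrite /pderiv /derive /=.
set g := foldr _ f s; rewrite -/g.
have -> : (fun h : R => h^-1 *: (((fun x => g (x - m)) \o shift x) (h *: delta_mx 0 i) - g (x - m))) =
   (fun h => h^-1 *: ((g \o shift (x - m)) (h *: delta_mx 0 i) - g (x - m))) => //.
by apply/funext => h /=; rewrite addrA.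
Qed.

Lemma smooth_translate f (m : 'rV[R]_n) : smooth f -> smooth (fun x => f (x - m)).
Proof.
move=> sf s x; rewrite iterated_translate.
by apply: (@differentiable_comp _ _ _ _ (fun x => x - m) (D s f)); last exact: sf.
Qed.

Lemma iterated_add f g s : smooth f -> smooth g ->
  D s (fun x => f x + g x) = (fun x => D s f x + D s g x).
Proof.
move=> sf sg; elim: s => [//|i s /= ->]; apply/funext => x.
by rewrite /pderiv deriveD//; apply: smooth_derivable; exact: smooth_iterated.
Qed.

Lemma smooth_add f g : smooth f -> smooth g -> smooth (fun x => f x + g x).
Proof.
move=> sf sg s x; rewrite iterated_add//.
by apply: differentiableD; [exact: sf | exact: sg].
Qed.

Lemma iterated_zero s : D s (fun _ => 0 : V) = (fun _ => 0).
Proof. by elim: s => [//|i s /= ->]; apply/funext => x; rewrite /pderiv derive_cst. Qed.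

Lemma smooth_zero : smooth (fun _ : 'rV[R]_n => 0 : V).
Proof. by move=> s x; rewrite iterated_zero; exact: differentiable_cst. Qed.

Lemma smooth_sum I (r : seq I) (P : pred I) (f : I -> 'rV[R]_n -> V) :
  (forall i, smooth (f i)) -> smooth (fun x => \sum_(i <- r | P i) f i x).
Proof.
move=> sf; elim: r => [|i r IH].
  by under eq_fun do rewrite big_nil; exact: smooth_zero.
under eq_fun do rewrite big_cons.
by case: (P i) => //; exact: smooth_add.
Qed.

Lemma iterated_sum I (r : seq I) (P : pred I) (f : I -> 'rV[R]_n -> V) s :
  (forall i, smooth (f i)) ->
  D s (fun x => \sum_(i <- r | P i) f i x) = (fun x => \sum_(i <- r | P i) D s (f i) x).
Proof.
move=> sf; elim: r => [|i r IH].
  under eq_fun do rewrite big_nil.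
  by under [RHS]eq_fun do rewrite big_nil; exact: iterated_zero.
under eq_fun do rewrite big_cons; under [RHS]eq_fun do rewrite big_cons.
case: (P i) => //; rewrite iterated_add ?IH//; exact: smooth_sum.
Qed.

End one.

(* The left-hand side is symmetric in [i] and [j], hence Schwarz's theorem. *)
Lemma double_difference (f : 'rV[R]_n -> R) i j (x : 'rV[R]_n) (h : R) : smooth f -> 0 < h ->
  let e (k : 'I_n) : 'rV[R]_n := delta_mx 0 k in
  exists s t : R, [/\ 0 < s < h, 0 < t < h &
    f (x + h *: e i + h *: e j) - f (x + h *: e i) - (f (x + h *: e j) - f x) =
    h * h * pderiv j (pderiv i f) (x + s *: e i + t *: e j)].
Proof.
move=> sf h0 e.
(* The mean value theorem is used twice: in direction [i] for [p], the increment of [f] over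
   [h *: e j], then in direction [j] for [q]. *)
pose p s := f (x + h *: e j + s *: e i) - f (x + s *: e i).
pose dp s := pderiv i f (x + h *: e j + s *: e i) - pderiv i f (x + s *: e i).
have pD (s : R) : is_derive s 1 p (dp s).
  by apply: is_deriveB; apply: is_derive_line; exact: smooth_derivable.
have [s sh pE] : exists2 s, s \in `]0, h[%R & p h - p 0 = dp s * (h - 0).
  apply: MVT => // s; apply: continuous_subspaceT => {}s.
  by apply/differentiable_continuous/derivable1_diffP; case: (pD s).
pose q t := pderiv i f (x + s *: e i + t *: e j).
pose dq t := pderiv j (pderiv i f) (x + s *: e i + t *: e j).
have qD (t : R) : is_derive t 1 q (dq t).
  by apply: is_derive_line; apply: smooth_derivable; exact: (smooth_iterated [:: i]).
have [t th qE] : exists2 t, t \in `]0, h[%R & q h - q 0 = dq t * (h - 0).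
  apply: MVT => // t; apply: continuous_subspaceT => {}t.
  by apply/differentiable_continuous/derivable1_diffP; case: (qD t).
exists s, t; split; [by move: sh; rewrite in_itv | by move: th; rewrite in_itv |].
move: pE qE; rewrite /p /dp /q /dq !scale0r !addr0 subr0.
rewrite (addrAC x (h *: e j) (h *: e i)) (addrAC x (h *: e j) (s *: e i)) => pE qE.
by rewrite pE qE; ring.
Qed.

Lemma norm_delta (i : 'I_n) : `|delta_mx 0 i : 'rV[R]_n| <= 1.
Proof.
rewrite [leLHS]mx_normrE; apply: bigmax_le => //= -[a b] _ /=; rewrite mxE.
by case: (_ && _); rewrite ?normr1 ?normr0.
Qed.

(** The same double difference equals [h * h] times either mixed derivative at some point near [x],
    so the two derivatives share a value arbitrarily close to [x]; continuity does the rest. *)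
Lemma pderivC_real (f : 'rV[R]_n -> R) i j : smooth f ->
  pderiv i (pderiv j f) = pderiv j (pderiv i f).
Proof.
move=> sf; apply/funext => x; set P := pderiv i _; set Q := pderiv j (pderiv i f).
apply/eqP; rewrite -subr_eq0 -normr_eq0; apply/eqP.
apply/le_anti/andP; split=> //; apply/ler_addgt0Pl => d d0; rewrite addr0.
have cP : {for x, continuous P} by apply: smooth_continuous; exact: (smooth_iterated [:: i; j]).
have cQ : {for x, continuous Q} by apply: smooth_continuous; exact: (smooth_iterated [:: j; i]).
have d2 : 0 < d / 2 by rewrite divr_gt0.
move/cvgrPdist_lt: cP => /(_ _ d2) cP; move/cvgrPdist_lt: cQ => /(_ _ d2) cQ.
have [r /= r0 Hr] := proj1 (@nbhs_normP _ _ _ _) (filterI cP cQ).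
(* Two displacements, each shorter than [r / 2], stay inside the ball of radius [r]. *)
have r2 : 0 < r / 2 by rewrite divr_gt0.
have [s [t [s_h t_h E1]]] := double_difference i j x sf r2.
have [s' [t' [s_h' t_h' E2]]] := double_difference j i x sf r2.
have near_x a b k l : 0 < a < r / 2 -> 0 < b < r / 2 ->
    `|x - (x + a *: delta_mx 0 k + b *: delta_mx 0 l)| < r.
  move=> /andP[a0 ar] /andP[b0 br]; rewrite -addrA opprD addNKr normrN.
  rewrite (le_lt_trans (ler_normD _ _))// !normrZ (gtr0_norm a0) (gtr0_norm b0).
  rewrite (splitr r) ltrD//.
    by apply: le_lt_trans ar; rewrite ler_piMr ?norm_delta ?ltW.
  by apply: le_lt_trans br; rewrite ler_piMr ?norm_delta ?ltW.
have [_ HQ] := Hr _ (near_x _ _ i j s_h t_h).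
have [HP _] := Hr _ (near_x _ _ j i s_h' t_h').
have : P (x + s' *: delta_mx 0 j + t' *: delta_mx 0 i) = Q (x + s *: delta_mx 0 i + t *: delta_mx 0 j).
  apply: (@mulfI _ (r / 2 * (r / 2))); first by rewrite mulf_neq0// gt_eqF.
  apply: etrans (esym E2) _; apply: etrans E1.
  have sw (a b c e : R) : a - b - (c - e) = a - c - (b - e) by ring.
  by rewrite (addrAC x) sw.
move=> PQ; rewrite PQ in HP.
rewrite distrC in HQ.
move: (P x) (Q x) (Q (x + _ + _)) HP HQ => a c b HP HQ.
clear -HP HQ.
have -> : a - c = (a - b) + (b - c) by ring.
by rewrite (le_trans (ler_normD _ _))// (splitr d) lerD// ltW.
Qed.

Lemma iterated_linear (V W : normedModType R) (L : {linear V -> W}) (f : 'rV[R]_n -> V) s :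
  continuous L -> smooth f -> D s (L \o f) = L \o D s f.
Proof.
move=> cL sf; elim: s => [//|i s /= ->]; apply/funext => x.
by apply: derive_comp_linear => //; apply: smooth_derivable; exact: smooth_iterated.
Qed.

Lemma smooth_linear (V W : normedModType R) (L : {linear V -> W}) (f : 'rV[R]_n -> V) :
  continuous L -> smooth f -> smooth (L \o f).
Proof.
move=> cL sf s x; rewrite iterated_linear//.
by apply: differentiable_comp; [exact: sf | exact: linear_differentiable].
Qed.

Lemma coord_inj (V : innerProductType R) (v w : V) :
  (forall i, coord (vbasis {:V}) i v = coord (vbasis {:V}) i w) -> v = w.
Proof.
move=> vw; rewrite (coord_vbasis (memvf v)) (coord_vbasis (memvf w)).
by apply: eq_bigr => i _; rewrite vw.
Qed.

Lemma pderivC (V : innerProductType R) (f : 'rV[R]_n -> V) i j : smooth f ->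
  pderiv i (pderiv j f) = pderiv j (pderiv i f).
Proof.
move=> sf; apply/funext => x; apply: coord_inj => a.
pose c : {linear V -> R^o} := coord (vbasis {:V}) a.
have cc : continuous c by exact: basis_coord_continuous.
have := pderivC_real i j (smooth_linear cc sf).
move: (iterated_linear [:: i; j] cc sf) (iterated_linear [:: j; i] cc sf).
by move=> /= -> -> /(congr1 (fun g => g x)).
Qed.

Lemma iterated_perm (V : innerProductType R) (f : 'rV[R]_n -> V) s t : smooth f ->
  perm_eq s t -> D s f = D t f.
Proof.
move=> sf; elim: s t => [t|i s IH t] st.
  by move: st; rewrite perm_sym => /perm_nilP->.
have /splitPr it : i \in t by rewrite -(perm_mem st) mem_head.
case: it st => t1 t2.
rewrite perm_sym -[i :: t2]cat1s perm_catCA perm_cons perm_sym => /IH /= ->.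
elim: t1 => [//|j t1 /= <-].
by rewrite pderivC//; exact: smooth_iterated.
Qed.

(** Multi-indices as lists of directions: composing derivatives becomes concatenation, and equality
    of multi-indices becomes equality up to permutation. *)
Definition mindex_seq k (a : mindex n k) : seq 'I_n :=
  flatten [seq nseq (a i) i | i <- enum 'I_n].

Lemma mderivE (V : normedModType R) k (a : mindex n k) (f : 'rV[R]_n -> V) :
  mderiv a f = D (mindex_seq a) f.
Proof.
rewrite /mderiv /mindex_seq; elim: (enum _) => [//|i s IH] /=.
rewrite foldr_cat -IH; elim: (nat_of_ord (a i)) => [//|m IHm] /=.
by rewrite IHm.
Qed.

Lemma count_mindex_seq k (a : mindex n k) i : count_mem i (mindex_seq a) = a i.
Proof.
rewrite /mindex_seq count_flatten -map_comp sumnE big_map big_enum/= (bigD1 i)//=.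
rewrite count_nseq/= eqxx mul1n big1 ?addn0// => j ji.
by rewrite count_nseq/= (negPf ji).
Qed.

Lemma size_mindex_seq k (a : mindex n k) : size (mindex_seq a) = mlength a.
Proof.
rewrite /mindex_seq size_flatten /shape -map_comp sumnE big_map big_enum/=.
by apply: eq_bigr => i _; rewrite /= size_nseq.
Qed.

End iterated.

(** * Composition of differential operators *)

(** The sum is the value at [x] of a polynomial whose coefficients collect the [c i] with equal
    exponents; a polynomial vanishing at as many naturals as its size is zero. *)
Lemma power_sum_coef (R : numDomainType) (I : finType) (P : pred I)
    (e : I -> nat) (c : I -> R) :
  (forall x : R, \sum_(i | P i) x ^+ e i * c i = 0) ->
  forall N : nat, \sum_(i | P i && (e i == N)) c i = 0.
Proof.
move=> c0 N; pose p : {poly R} := \sum_(i | P i) (c i)%:P * 'X^(e i).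
have p0 x : p.[x] = 0.
  rewrite horner_sum; apply: etrans (c0 x); apply: eq_bigr => i _.
  by rewrite hornerCM hornerXn mulrC.
have -> : \sum_(i | P i && (e i == N)) c i = p`_N.
  rewrite coef_sum big_mkcondr/=; apply: eq_bigr => i _.
  by rewrite coefCM coefXn eq_sym; case: eqP => _; rewrite (mulr1, mulr0).
suff -> : p = 0 by rewrite coef0.
apply: (@roots_geq_poly_eq0 _ _ [seq m%:R | m <- iota 0 (size p)]).
- by apply/allP => x _; rewrite /root p0.
- rewrite map_inj_uniq ?iota_uniq// => a b /eqP.
  by rewrite eqr_nat => /eqP.
- by rewrite size_map size_iota.
Qed.

(** Uniqueness of the expansion in base [M]: the remainder modulo [M] is the digit at [ord0], and
    the quotient carries the others. *)
Lemma digits_inj (n M : nat) (a b : 'I_n -> nat) :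
  (forall i, a i < M)%N -> (forall i, b i < M)%N ->
  (\sum_(i < n) a i * M ^ i = \sum_(i < n) b i * M ^ i)%N -> a =1 b.
Proof.
elim: n a b => [a b _ _ _ []//|n IH a b aM bM].
have split_digits (f : 'I_n.+1 -> nat) : (\sum_(i < n.+1) f i * M ^ i =
    (\sum_(i < n) f (lift ord0 i) * M ^ i) * M + f ord0)%N.
  rewrite big_ord_recl/= expn0 muln1 addnC big_distrl/=; congr (_ + _)%N.
  by apply: eq_bigr => i _; rewrite /bump/= add1n expnS mulnCA mulnC.
rewrite !split_digits => ab.
have a0 : a ord0 = b ord0.
  by have := congr1 (modn^~ M) ab; rewrite /= !modnMDl !modn_small.
have /IH al : (\sum_(i < n) a (lift ord0 i) * M ^ i = \sum_(i < n) b (lift ord0 i) * M ^ i)%N.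
  move: ab; rewrite a0 => /addIn/eqP; rewrite eqn_mul2r => /orP[/eqP M0|/eqP//].
  by have := aM ord0; rewrite M0.
move=> i; case: (unliftP ord0 i) => [j ->|->//]; exact: al.
Qed.

Section composition.
Context (R : realType) (n : nat).

(** The number whose digits in base [M] are the multiplicities of the directions in [s], provided
    these are below [M]. *)
Definition digit_sum (M : nat) (s : seq 'I_n) : nat := (\sum_(i <- s) M ^ i)%N.

Lemma digit_sumE M s : digit_sum M s = (\sum_(i < n) count_mem i s * M ^ i)%N.
Proof.
elim: s => [|j s IH]; first by rewrite /digit_sum big_nil big1.
rewrite /digit_sum big_cons -/(digit_sum M s) IH/= (eq_bigr _ (fun i _ => mulnDl _ _ _)).
rewrite big_split/=; congr (_ + _)%N.
rewrite (bigD1 j)//= eqxx mul1n big1 ?addn0// => i ij.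
by rewrite eq_sym (negPf ij).
Qed.

Lemma digit_sum_perm M s t : (size s < M)%N -> (size t < M)%N ->
  digit_sum M s = digit_sum M t -> perm_eq s t.
Proof.
move=> sM tM; rewrite !digit_sumE => st.
apply/allP => /= i _; apply/eqP; move: i; apply: digits_inj st => i.
  exact: leq_ltn_trans (count_size _ _) sM.
exact: leq_ltn_trans (count_size _ _) tM.
Qed.

(* Kronecker substitution: when [M] exceeds all exponents, distinct monomials
   take distinct powers of [x] as values at this point. *)
Definition kronecker_point (M : nat) (x : R) : 'rV[R]_n := \row_i x ^+ (M ^ i).

Lemma monomial_kronecker M k (a : mindex n k) x :
  monomial a (kronecker_point M x) = x ^+ digit_sum M (mindex_seq a).
Proof.
rewrite digit_sumE -prodrXr; apply: eq_bigr => i _.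
by rewrite mxE -exprM count_mindex_seq mulnC.
Qed.

Lemma symbolE (V W : vectType R) k (A : operator n V W k) xi v :
  symbol A xi v = \sum_(a : mindex n k | mlength a == k) monomial a xi *: A a v.
Proof. by rewrite /symbol sum_lfunE; apply: eq_bigr => a _; rewrite scale_lfunE. Qed.

(** Settles the frequency [0], about which the kernel condition says nothing: a monomial of positive
    degree vanishes there. *)
Lemma symbol0 (V W : vectType R) k (A : operator n V W k) v : (0 < k)%N ->
  symbol A 0 v = 0.
Proof.
move=> k0; rewrite symbolE big1// => a /eqP ak.
have [i ai] : exists i, (0 < a i)%N.
  apply/existsP; rewrite -[X in is_true X]negbK negb_exists; apply/negP => /forallP a0.
  move: k0; rewrite -ak /mlength big1// => i _; move: (a0 i).
  by rewrite lt0n negbK => /eqP.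
by rewrite /monomial (bigD1 i)//= mxE expr0n gtn_eqF// mul0r scale0r.
Qed.

Context (U V W : innerProductType R).

Lemma smooth_apply_operator k (A : operator n V W k) (f : 'rV[R]_n -> V) :
  smooth f -> smooth (apply_operator A f).
Proof.
move=> sf; apply: smooth_sum => a.
apply: (@smooth_linear _ _ _ _ (A a) (mderiv a f)); first exact: linear_findim_continuous.
by rewrite mderivE; exact: smooth_iterated.
Qed.

Lemma apply_operator_near k (A : operator n V W k) (f g : 'rV[R]_n -> V) (x : 'rV[R]_n) :
  (\forall y \near x, f y = g y) -> apply_operator A f x = apply_operator A g x.
Proof.
move=> fg; apply: eq_bigr => a _; rewrite !mderivE.
by rewrite (nbhs_singleton (iterated_near (mindex_seq a) fg)).
Qed.

Lemma apply_operator_translate k (A : operator n V W k) (f : 'rV[R]_n -> V) m x :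
  apply_operator A (fun x => f (x - m)) x = apply_operator A f (x - m).
Proof. by apply: eq_bigr => a _; rewrite !mderivE iterated_translate. Qed.

(** The composition is a sum over pairs of multi-indices. Pairs with the same exponent at the
    Kronecker point carry the same derivative of [u], and their coefficients [A a (B b v)] sum to
    zero because the product of the symbols vanishes at every such point. *)
Lemma apply_operator_comp_eq0 k l (A : operator n V W k) (B : operator n U V l)
    (u : 'rV[R]_n -> U) (x : 'rV[R]_n) :
  (0 < l)%N ->
  (forall xi, xi != 0 -> lker (symbol A xi) = limg (symbol B xi)) ->
  smooth u -> apply_operator A (apply_operator B u) x = 0.
Proof.
move=> l0 AB su; pose M := (k + l).+1.
pose P (p : mindex n k * mindex n l) := (mlength p.1 == k) && (mlength p.2 == l).
pose s (p : mindex n k * mindex n l) := mindex_seq p.1 ++ mindex_seq p.2.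
pose e p := digit_sum M (s p).
pose d p : U := foldr (@pderiv R n _) u (s p) x.
have ed p q : P p -> P q -> e p = e q -> d p = d q.
  have sM r : P r -> (size (s r) < M)%N.
    by move=> /andP[/eqP r1 /eqP r2]; rewrite size_cat !size_mindex_seq r1 r2.
  move=> Pp Pq epq; rewrite /d (@iterated_perm _ _ _ u (s p) (s q))//.
  by apply: digit_sum_perm epq; exact: sM.
have sB b : smooth (B b \o mderiv b u).
  apply: (@smooth_linear _ _ _ _ (B b)); first exact: linear_findim_continuous.
  by rewrite mderivE; exact: smooth_iterated.
have -> : apply_operator A (apply_operator B u) x = \sum_(p | P p) A p.1 (B p.2 (d p)).
  rewrite /apply_operator -(pair_big (fun a : mindex n k => mlength a == k)
    (fun b : mindex n l => mlength b == l) (fun a b => A a (B b (d (a, b)))))/=.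
  apply: eq_bigr => a _; rewrite mderivE.
  rewrite (@iterated_sum _ _ _ _ _ _ (fun b => B b \o mderiv b u))//.
  rewrite linear_sum; apply: eq_bigr => b _; congr (A a _).
  rewrite iterated_linear//=; last 2 first.
    exact: linear_findim_continuous.
    by rewrite mderivE; exact: smooth_iterated.
  by rewrite mderivE /d /s /= foldr_cat.
have AB0 xi v : symbol A xi (symbol B xi v) = 0.
  have [->|xi0] := eqVneq xi 0; first by rewrite (symbol0 _ _ l0) linear0.
  by apply/eqP; rewrite -memv_ker AB// memv_img ?memvf.
have coef0 N v : \sum_(p | P p && (e p == N)) A p.1 (B p.2 v) = 0.
  apply: coord_inj => i; rewrite linear0 linear_sum/=.
  apply: (@power_sum_coef _ _ P e (fun p => coord (vbasis {:W}) i (A p.1 (B p.2 v)))) => y.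
  have := congr1 (coord (vbasis {:W}) i) (AB0 (kronecker_point M y) v).
  rewrite linear0 symbolE linear_sum; apply: etrans.
  rewrite -(pair_big (fun a : mindex n k => mlength a == k)
    (fun b : mindex n l => mlength b == l)
    (fun a b => y ^+ e (a, b) * coord (vbasis {:W}) i (A a (B b v))))/=.
  apply: eq_bigr => a _; rewrite linearZ/= symbolE !linear_sum [RHS]mulr_sumr.
  apply: eq_bigr => b _; rewrite !linearZ/= !monomial_kronecker mulrA -exprD.
  by rewrite /e /digit_sum /s big_cat.
(* A crude bound on all exponents, which lets them index a finite partition of the pairs. *)
pose m := \sum_(p | P p) e p.
rewrite (partition_big (fun p => inord (e p) : 'I_m.+1) predT)//= big1// => j _.
have [p /andP[Pp /eqP ej]|] := pickP (fun p => P p && (inord (e p) == j)); last first.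
  by move=> none; rewrite big_pred0.
have em q : P q -> (e q < m.+1)%N.
  by move=> Pq; rewrite ltnS /m (bigD1 q)//= leq_addr.
have PE q : P q && (inord (e q) == j) = P q && (e q == e p).
  have [Pq|//] := boolP (P q); rewrite -ej -val_eqE /= !inordK// em//.
rewrite (eq_bigl _ _ PE); apply: etrans (coef0 (e p) (d p)); apply: eq_bigr => q /andP[Pq /eqP eq].
by rewrite (ed q p).
Qed.

End composition.

(** * Lebesgue measure on tuples *)

Section tuples.
Context (R : realType).
Local Notation mR := (measurableTypeR R).
Local Notation leb := (@lebesgue_measure R : {sigma_finite_measure set mR -> \bar R}).
Local Notation lebn n := (lebesgue_tuple R n).

Definition tcube n : set (n.-tuple mR) := @row_of_tuple R n @^-1` @cube R n.

Lemma tcubeE n : @tcube n = \bigcap_(i in [set: 'I_n]) ((@tnth _ _)^~ i @^-1` `]0, 1[).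
Proof.
apply/seteqP; split=> t tc i; first by move=> _; move: (tc i); rewrite mxE /= in_itv.
by have := tc i Logic.I; rewrite mxE /= in_itv.
Qed.

Lemma measurable_tcube n : measurable (@tcube n).
Proof.
rewrite tcubeE; apply: fin_bigcap_measurable => // i _.
by rewrite -[X in measurable X]setTI; apply: measurable_tnth.
Qed.

Lemma tcons_preimage_tcube n :
  @tcons R n @^-1` @tcube n.+1 = `]0, 1[ `*` @tcube n.
Proof.
apply/seteqP; split=> [[a t] /= tc|[a t] /= [/= a01 tc] i].
  split=> /=; first by have := tc ord0; rewrite mxE in_itv.
  move=> i; have := tc (lift ord0 i); rewrite !mxE.
  by rewrite (_ : tnth (tcons (a, t)) (lift ord0 i) = tnth t i)// !(tnth_nth 0).
have [j ->|->] := unliftP ord0 i; rewrite mxE; last by move: a01; rewrite in_itv.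
have := tc j; rewrite mxE.
by rewrite (_ : tnth (tcons (a, t)) (lift ord0 j) = tnth t j)// !(tnth_nth 0).
Qed.

Lemma lebesgue_tcube n : lebn n (@tcube n) = 1%E.
Proof.
elim: n => [|n IH].
  rewrite /= diracE mem_set//; by move=> -[].
rewrite /= /lebesgue_cons /pushforward tcons_preimage_tcube.
rewrite product_measure1E ?IH ?mule1//; last exact: measurable_tcube.
by rewrite [LHS](lebesgue_measure_itv `]0, 1[)/= lte_fin ltr01 -EFinB subr0.
Qed.

Definition tset n (t : n.-tuple mR) (i : 'I_n) (s : mR) : n.-tuple mR :=
  [tuple if j == i then s else tnth t j | j < n].

Lemma tset_tcons0 n a (t : n.-tuple mR) s : tset (tcons (a, t)) ord0 s = tcons (s, t).
Proof.
apply: eq_from_tnth => j; rewrite tnth_mktuple.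
have [k ->|->] := unliftP ord0 j; last by rewrite eqxx.
by rewrite eq_sym (negPf (neq_lift _ _)) !(tnth_nth 0).
Qed.

Lemma tnth_tcons_lift n a (t : n.-tuple mR) i :
  tnth (tcons (a, t)) (lift ord0 i) = tnth t i.
Proof. by rewrite !(tnth_nth 0). Qed.

Lemma tset_tcons_lift n a (t : n.-tuple mR) i s :
  tset (tcons (a, t)) (lift ord0 i) s = tcons (a, tset t i s).
Proof.
apply: eq_from_tnth => j; rewrite tnth_mktuple.
have [k ->|->] := unliftP ord0 j; last by rewrite (negPf (neq_lift _ _)).
by rewrite (inj_eq lift_inj) !tnth_tcons_lift tnth_mktuple.
Qed.

Lemma bounded_integrable_support d (T : measurableType d)
    (mu : {measure set T -> \bar R}) (D : set T) (f : T -> R) (C : R) :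
  measurable D -> (mu D < +oo)%E ->
  measurable_fun setT f -> (forall t, `|f t| <= C) -> (forall t, ~ D t -> f t = 0) ->
  mu.-integrable setT (EFin \o f).
Proof.
move=> mD Doo mf fC f0.
have -> : EFin \o f = (EFin \o f) \_ D.
  by apply/funext => t; rewrite patchE; case: ifPn => // /negP; rewrite inE => /f0 /= ->.
apply/(integrable_mkcond _ mD).
apply: measurable_bounded_integrable => //; first exact: measurable_funTS.
exists C; split; first exact: num_real.
by move=> M CM t _ /=; apply: le_trans (fC t) (ltW CM).
Qed.

(** Fubini by induction on [n]: if [i] is the first coordinate it is integrated first, otherwise the
    induction hypothesis annihilates the integral over the tail. The bound and the support in the
    cube provide integrability. *)
Lemma integral_tuple_eq0 n (i : 'I_n) (f : n.-tuple mR -> R) (C : R) :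
  measurable_fun setT f -> (forall t, `|f t| <= C) -> (forall t, ~ tcube t -> f t = 0) ->
  (forall t, (\int[leb]_s (f (tset t i s))%:E = 0)%E) ->
  (\int[lebn n]_t (f t)%:E = 0)%E.
Proof.
elim: n i f => [[]//|n IH] i f mf fC f0 fi.
have mfc : measurable_fun setT (f \o @tcons R n).
  by apply: measurableT_comp => //; exact: measurable_tcons.
have intf : (leb \x lebn n)%E.-integrable setT (EFin \o (f \o @tcons R n)).
  have := @bounded_integrable_support _ _ (leb \x lebn n)%E (`]0%R, 1%R[ `*` @tcube n) (f \o @tcons R n) C.
  apply => //.
  - by apply: measurableX; [exact: measurable_itv | exact: measurable_tcube].
  - rewrite -tcons_preimage_tcube.
    have := lebesgue_tcube n.+1; rewrite /= /lebesgue_cons /pushforward => ->.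
    exact: ltry.
  - by move=> t; exact: fC.
  - by move=> t ft; apply: f0; rewrite -tcons_preimage_tcube in ft.
transitivity (\int[(leb \x lebn n)%E]_x (f (tcons x))%:E)%E.
  apply: (integral_pushforward (@measurable_tcons R n) _ _ measurableT).
    exact/measurable_EFinP.
  exact: intf.
have [j ij|i0] := unliftP ord0 i; last first.
  rewrite -integral21_prod_meas1//; apply: integral0_eq => t _.
  rewrite /fubini_G -(fi (tcons (0, t))) i0; apply: eq_integral => s _ /=.
  by rewrite tset_tcons0.
rewrite -integral12_prod_meas1//; apply: integral0_eq => s _.
apply: (IH j (fun t => f (tcons (s, t)))) => //.
- apply: (measurableT_comp mfc).
  by apply: measurable_fun_pair => //; exact: measurable_cst.
- move=> t nt; apply: f0 => st; have : (@tcons R n @^-1` @tcube n.+1) (s, t) by [].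
  by rewrite tcons_preimage_tcube => -[].
- by move=> t; rewrite -[RHS](fi (tcons (s, t))); apply: eq_integral => a _; rewrite ij tset_tcons_lift.
Qed.

Lemma integral_derive_eq0 (h dh : R -> R) :
  (forall x : R, is_derive x 1 h (dh x)) -> continuous dh ->
  (forall x, ~ 0 < x < 1 -> h x = 0 /\ dh x = 0) ->
  (\int[leb]_s (dh s)%:E = 0)%E.
Proof.
move=> hD cdh h0.
have ch : continuous h.
  by move=> x; apply/differentiable_continuous/derivable1_diffP; case: (hD x).
have -> : (\int[leb]_s (dh s)%:E)%E = (\int[leb]_(s in `[0%R, 1%R]) (dh s)%:E)%E.
  rewrite [RHS]integral_mkcond; apply: eq_integral => s _.
  rewrite patchE; case: ifPn => // /negP; rewrite inE/= in_itv/= => s01.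
  rewrite (h0 s _).2// => /andP[s0 s1]; apply: s01.
  by rewrite !ltW.
rewrite (@continuous_FTC2 _ dh h)//.
- have [-> _] := h0 0 ltac:(by rewrite ltxx).
  have [-> _] := h0 1 ltac:(by rewrite ltxx andbF).
  by rewrite subee.
- exact: continuous_subspaceT.
- split.
  + by move=> x _; case: (hD x).
  + by apply: cvg_at_right_filter; exact: ch.
  + by apply: cvg_at_left_filter; exact: ch.
- by move=> x _; rewrite derive1E; case: (hD x).
Qed.

(** Tuples carry the product sigma-algebra, so an open set is written as a countable union of
    rational boxes, each a finite intersection of coordinate conditions. *)
Lemma measurable_row_of_tuple n (O : set 'rV[R]_n) : open O ->
  measurable (@row_of_tuple R n @^-1` O).
Proof.
move=> oO; pose box (p : 'rV[rat]_n * nat) : set 'rV[R]_n :=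
  [set x | forall i, `|ratr (p.1 0 i) - x 0 i| < p.2.+1%:R^-1].
have -> : O = \bigcup_(p : 'rV[rat]_n * nat) (if `[< box p `<=` O >] then box p else set0).
  apply/seteqP; split=> [x Ox|x [p _]]; last by case: ifPn => // /asboolP; apply.
  have /nbhs_ballP[e /= e0 xeO] : nbhs x O by exact: open_nbhs_nbhs.
  have e2 : 0 < e / 2 by rewrite divr_gt0.
  (* The box has radius below [e / 2] and its rational centre is as close to [x], so the box lies in
     the [e]-ball around [x]. *)
  have [k] := ltr_add_invr e2; rewrite add0r => ke.
  have k0 : 0 < k.+1%:R^-1 :> R by rewrite invr_gt0.
  have /choice[q qx] i : exists q : rat, `|ratr q - x 0 i| < k.+1%:R^-1.
    have /rat_in_itvoo[q] : x 0 i - k.+1%:R^-1 < x 0 i + k.+1%:R^-1.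
      by rewrite ltrD2l gt0_cp.
    by rewrite in_itv/= => qi; exists q; rewrite ltr_distl.
  exists (\row_i q i, k) => //; case: ifPn => [_ i|/asboolP]; first by rewrite mxE.
  case=> y yb; apply: xeO; split => // a i; rewrite (ord1 a).
  have := yb i; rewrite mxE => qy; rewrite /ball/= -(subrKA (ratr (q i))).
  rewrite (le_lt_trans (ler_normD _ _))// (splitr e) ltrD//; last exact: lt_trans ke.
  by rewrite distrC; exact: lt_trans ke.
rewrite preimage_bigcup; apply: countable_bigcupT_measurable; first exact: countableP.
move=> p; case: ifPn => _; last by rewrite preimage_set0.
have -> : @row_of_tuple R n @^-1` box p = \bigcap_(i in [set: 'I_n])
   ((@tnth _ _)^~ i @^-1` (ball (ratr (p.1 0 i) : R) p.2.+1%:R^-1)).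
  apply/seteqP; split=> t tc i; first by move=> _; move: (tc i); rewrite mxE.
  by have := tc i Logic.I; rewrite mxE.
apply: fin_bigcap_measurable => // i _.
rewrite -[X in measurable X]setTI; apply: measurable_tnth => //.
exact: measurable_ball.
Qed.

Lemma continuous_measurable_tuple n (g : 'rV[R]_n -> R) : continuous g ->
  measurable_fun setT (g \o @row_of_tuple R n).
Proof.
move=> /continuousP cg; apply: (measurability _ (RGenOpens.measurableE R)).
move=> _ [_ [a [b ->] <-]]; rewrite setTI comp_preimage.
by apply: measurable_row_of_tuple; apply: cg; exact: interval_open.
Qed.

End tuples.

(** * Compactly supported fields and their periodic extensions *)

Section compactly_supported.
Context (R : realType) (n : nat) (K : set 'rV[R]_n).
Hypotheses (cK : compact K) (Kcube : K `<=` @cube R n).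
Local Notation mR := (measurableTypeR R).
Local Notation lebn := (lebesgue_tuple R n).
Local Notation D s f := (foldr (@pderiv R n _) f s).

Lemma closed_support : closed K.
Proof. by apply: compact_closed => //; exact: norm_hausdorff. Qed.

Lemma near_off_support (V : normedModType R) (f : 'rV[R]_n -> V) x :
  (forall x, ~ K x -> f x = 0) -> ~ K x -> \forall y \near x, f y = 0.
Proof.
move=> f0 Kx; have : nbhs x (~` K).
  by apply: open_nbhs_nbhs; split => //; exact/closed_openC/closed_support.
by apply: filterS => y; exact: f0.
Qed.

Lemma iterated_off_support (V : normedModType R) (f : 'rV[R]_n -> V) s :
  (forall x, ~ K x -> f x = 0) -> forall x, ~ K x -> D s f x = 0.
Proof.
move=> f0 x Kx; have fx := near_off_support f0 Kx.
have := @iterated_near _ _ _ _ (fun _ => 0) s _ fx.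
by move/nbhs_singleton => ->; rewrite iterated_zero.
Qed.

Lemma integrable_support (g : 'rV[R]_n -> R) : continuous g ->
  (forall x, ~ K x -> g x = 0) ->
  lebn.-integrable setT (EFin \o (g \o @row_of_tuple R n)).
Proof.
move=> cg g0.
have /compact_bounded[M [Mr MB]] : compact (g @` K).
  by apply: continuous_compact => //; exact: continuous_subspaceT.
(* Every number above [M] is a bound on [K]; [|M| + 1] is one of them, and being nonnegative it also
   serves off [K]. *)
apply: (@bounded_integrable_support _ _ _ _ (@tcube R n) _ (`|M| + 1)).
- exact: measurable_tcube.
- by rewrite [X in (X < _)%E]lebesgue_tcube ltry.
- exact: continuous_measurable_tuple.
- move=> t /=; have [Kt|/g0 ->] := pselect (K (row_of_tuple t)); last first.
    by rewrite normr0 addr_ge0.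
  apply: MB; last by exists (row_of_tuple t).
  by rewrite (le_lt_trans (ler_norm _))// ltrDl.
- by move=> t nt; apply: g0 => /Kcube.
Qed.

Lemma cube_integral_support (g : 'rV[R]_n -> R) :
  (forall x, ~ K x -> g x = 0) ->
  cube_integral g = fine (\int[lebn]_t (g (row_of_tuple t))%:E)%E.
Proof.
move=> g0; rewrite /cube_integral Rintegral_mkcond.
rewrite /Rintegral; congr fine; apply: eq_integral => t _.
rewrite patchE; case: ifPn => // /negP; rewrite inE => nt.
by rewrite g0// => /Kcube.
Qed.

Lemma row_of_tset (t : n.-tuple mR) i s :
  row_of_tuple (tset t i s) = row_of_tuple (tset t i 0) + s *: delta_mx 0 i.
Proof.
apply/rowP => j; rewrite !mxE !tnth_mktuple eqxx/=.
by case: eqP => _; rewrite ?(mulr1, mulr0, add0r, addr0).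
Qed.

Lemma integral_pderiv (g : 'rV[R]_n -> R) i : smooth g ->
  (forall x, ~ K x -> g x = 0) ->
  (\int[lebn]_t (pderiv i g (row_of_tuple t))%:E = 0)%E.
Proof.
move=> sg g0; have dg0 := iterated_off_support [:: i] g0; rewrite /= in dg0.
have cdg : continuous (pderiv i g) by apply/smooth_continuous/(smooth_iterated [:: i]).
have [C gC] : exists C, forall x, `|pderiv i g x| <= C.
  have /compact_bounded[M [Mr MB]] : compact (pderiv i g @` K).
    by apply: continuous_compact => //; exact: continuous_subspaceT.
  exists (`|M| + 1) => x; have [Kt|/dg0 ->] := pselect (K x); last first.
    by rewrite normr0 addr_ge0.
  apply: MB; last by exists x.
  by rewrite (le_lt_trans (ler_norm _))// ltrDl.
apply: (@integral_tuple_eq0 _ _ i (pderiv i g \o @row_of_tuple R n) C).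
- exact: continuous_measurable_tuple.
- by move=> t; exact: gC.
- by move=> t nt; apply: dg0 => /Kcube.
(* The base point has [i]-th coordinate [0], so the parameter [s] is the [i]-th coordinate and the
   line meets [K] only for [0 < s < 1]. *)
move=> t; pose x0 := row_of_tuple (tset t i 0).
under eq_integral do rewrite /= row_of_tset.
apply: (@integral_derive_eq0 _ (fun s => g (x0 + s *: delta_mx 0 i))
  (fun s => pderiv i g (x0 + s *: delta_mx 0 i))).
- by move=> s; apply: is_derive_line; exact: smooth_derivable.
- move=> s; apply: (@continuous_comp _ _ _ (fun s : R => x0 + s *: delta_mx 0 i) (pderiv i g)).
    by apply: cvgD; [exact: cvg_cst | apply: cvgZr_tmp].
  exact: cdg.
- move=> s s01; have Ks : ~ K (x0 + s *: delta_mx 0 i).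
    move=> /Kcube/(_ i); rewrite !mxE tnth_mktuple !eqxx/= mulr1 add0r.
    exact: s01.
  by rewrite g0// dg0.
Qed.

Definition fractional (x : 'rV[R]_n) : 'rV[R]_n :=
  \row_i (x 0 i - (Num.floor (x 0 i))%:~R).

Definition periodization (V : Type) (f : 'rV[R]_n -> V) x := f (fractional x).

Lemma fractional_cube x : @cube R n x -> fractional x = x.
Proof.
move=> xc; apply/rowP => i; rewrite mxE; have /andP[x0 x1] := xc i.
rewrite (@floor_def _ _ 0) ?subr0//; by rewrite ltW//= add0r.
Qed.

Lemma periodization_periodic (W : Type) (f : 'rV[R]_n -> W) :
  cube_periodic (periodization f).
Proof.
move=> i x; congr f; apply/rowP => j; rewrite !mxE floorDrz; last first.
  by rewrite rpred_nat.
by rewrite intrD opprD addrACA; case: (j == i); rewrite ?floor1 ?floor0 subrr addr0.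
Qed.

(* Only finitely many lattice translates matter near [x], and all of them except
   the one by [floor x] move [x] out of the closed set [K]. *)
Lemma periodization_near (W : normedModType R) (f : 'rV[R]_n -> W) (x : 'rV[R]_n) :
  (forall x, ~ K x -> f x = 0) ->
  \forall y \near x, periodization f y = f (y - \row_i (Num.floor (x 0 i))%:~R).
Proof.
move=> f0; pose m i := Num.floor (x 0 i).
(* The integer points within one of the floor of [x] in each coordinate: the only possible floors of
   points at distance less than 1 from [x]. *)
pose m' (e : {ffun 'I_n -> 'I_3}) i : int := m i - 1 + (e i : nat)%:Z.
have floor_cube y (p : 'I_n -> int) i :
    @cube R n (y - \row_i (p i)%:~R) -> Num.floor (y 0 i) = p i.
  move=> /(_ i); rewrite !mxE subr_gt0 ltrBlDl => /andP[py yp].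
  by apply: floor_def; rewrite ltW//= intrD.
have far : \forall y \near nbhs x, forall e, (exists i, m' e i != m i) ->
    f (y - \row_i (m' e i)%:~R) = 0.
  apply: (@filter_forall _ _ (fun e => [set y | (exists i, m' e i != m i) ->
    f (y - \row_i (m' e i)%:~R) = 0]) (nbhs x)) => e.
  have [[i emi]|em] := pselect (exists i, m' e i != m i); last by near=> y.
  have Kx : ~ K (x - \row_i (m' e i)%:~R).
    by move=> /Kcube/floor_cube => /(_ i) mi; rewrite /m mi eqxx in emi.
  have cx : {for x, continuous (fun y : 'rV[R]_n => y - \row_i (m' e i)%:~R)}.
    exact: differentiable_continuous.
  have fx : nbhs x (fun y => f (y - \row_i (m' e i)%:~R) = 0).
    exact: (cx _ (near_off_support f0 Kx)).
  by apply: filterS fx => y /= fy _.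
have close : nbhs x (fun y : 'rV[R]_n => forall i, `|x 0 i - y 0 i| < 1).
  have := nbhsx_ballx x 1 ltr01; apply: filterS => y [_ xy] i; exact: xy.
apply: filterS2 far close => y far close.
pose e : {ffun 'I_n -> 'I_3} := [ffun i => inord (absz (Num.floor (y 0 i) - (m i - 1))%R)].
have m'E i : m' e i = Num.floor (y 0 i).
  have := close i; rewrite ltr_distlC => /andP[xy yx].
  have ge_m : m i - 1 <= Num.floor (y 0 i).
    rewrite floor_ge_int intrD (le_trans _ (ltW xy))// lerD2r.
    exact: floor_le.
  have lt_m : Num.floor (y 0 i) < m i + 2.
    have := floorD1_gt (x 0 i); rewrite floor_lt_int !intrD -(ltrD2r 1) => xm.
    apply: lt_trans yx (lt_le_trans xm _); rewrite -addrA lerD2l; exact: lexx.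
  rewrite /m' ffunE inordK; last by lia.
  by rewrite gez0_abs ?subr_ge0// addrC subrK.
rewrite /periodization.
have -> : fractional y = y - \row_i (m' e i)%:~R.
  by apply/rowP => i; rewrite !mxE m'E.
(* If the floors of [x] and [y] differ, both sides vanish: the left by [far], the right because a
   point of [K] there would force the floors to agree. *)
have [[i emi]|em] := pselect (exists i, m' e i != m i).
  rewrite far; last by exists i.
  rewrite f0// => /Kcube/floor_cube => /(_ i) mi.
  by rewrite m'E mi eqxx in emi.
congr (f (_ - _)); apply/rowP => i; rewrite !mxE.
by have [->//|emi] := eqVneq (m' e i) (m i); case: em; exists i.
Unshelve. all: by end_near. Qed.

Context (U V : innerProductType R) (l : nat) (B : operator n U V l)
  (u : 'rV[R]_n -> U).
Hypotheses (l_gt0 : (0 < l)%N) (su : smooth u) (u0 : forall x, ~ K x -> u x = 0).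

Lemma apply_operator_off_support x : ~ K x -> apply_operator B u x = 0.
Proof.
move=> Kx; rewrite /apply_operator big1// => b _.
by rewrite mderivE iterated_off_support// linear0.
Qed.

(** Each term is a derivative of a compactly supported scalar function, and [0 < l] guarantees an
    outermost derivative to integrate away. *)
Lemma integral_operator (c : {linear V -> R^o}) :
  (\int[lebn]_t (c (apply_operator B u (row_of_tuple t)))%:E = 0)%E.
Proof.
pose L b : {linear U -> R^o} := c \o B b.
have cL b : continuous (L b) by exact: linear_findim_continuous.
have sL b : smooth (L b \o u) by exact: smooth_linear.
have L0 b x : ~ K x -> (L b \o u) x = 0 by move=> /u0 ux; rewrite /L /= ux !linear0.
have cE x : c (apply_operator B u x) =
    \sum_(b : mindex n l | mlength b == l) D (mindex_seq b) (L b \o u) x.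
  rewrite linear_sum; apply: eq_bigr => b _.
  by rewrite (iterated_linear _ (cL b) su) mderivE.
under eq_integral do rewrite cE -sumEFin.
rewrite (integral_sum measurableT); last first.
  move=> b; apply: (@integrable_support (D (mindex_seq b) (L b \o u))).
    exact/smooth_continuous/smooth_iterated.
  by apply: iterated_off_support => x; exact: L0.
rewrite big1// => b /eqP bl.
have := size_mindex_seq b; rewrite bl.
case: (mindex_seq b) => [l0|i s _].
  by move: l_gt0; rewrite -l0.
apply: integral_pderiv; first exact: smooth_iterated.
by apply: iterated_off_support => x; exact: L0.
Qed.

Lemma cube_integral_operator (c : {linear V -> R^o}) :
  cube_integral (fun x => c (apply_operator B u x)) = 0.
Proof.
rewrite cube_integral_support ?integral_operator// => x /apply_operator_off_support ->.
by rewrite linear0.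
Qed.

Lemma cube_integral_add_operator (c : {linear V -> R^o}) (z : V) :
  cube_integral (fun x => c (z + apply_operator B u x)) = c z.
Proof.
have mc := @measurable_tcube R n.
rewrite /cube_integral.
under eq_Rintegral do rewrite linearD.
rewrite RintegralD//.
- rewrite [X in _ + X]cube_integral_operator addr0 Rintegral_cst//.
  by rewrite [X in fine X]lebesgue_tcube mulr1.
- apply: (@measurable_bounded_integrable _ _ _ _ (cst (c z))) => //.
    by rewrite [X in (X < _)%E]lebesgue_tcube ltry.
  exists `|c z|; split; first exact: num_real.
  by move=> M cM t _ /=; exact: ltW.
- apply: (integrableS measurableT) => //.
  apply: (@integrable_support (c \o apply_operator B u)).
    move=> x; apply: continuous_comp; last exact: linear_findim_continuous.
    exact/smooth_continuous/smooth_apply_operator.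
  by move=> x /apply_operator_off_support /= ->; rewrite linear0.
Qed.

End compactly_supported.

(** The expansion of [g] at [x] is also one of [f], and uniqueness of the differential identifies
    ['d f x] with ['d g x]. *)
Lemma near_eq_differentiable (R : realType) (V W : normedModType R)
    (f g : V -> W) (x : V) :
  (\forall y \near x, f y = g y) -> differentiable g x -> differentiable f x.
Proof.
move=> fg dg.
have cdg : continuous ('d g x) by exact: diff_continuous.
have fE : f \o shift x = cst (f x) + 'd g x +o_ (0 : V) id.
  apply/eqaddoP => e e0; have := diff_locally dg => /eqaddoP/(_ e e0).
  have fg0 : \forall h \near (0 : V), f (h + x) = g (h + x).
    by move: fg; rewrite (near_shift 0 x); apply: filterS => h; rewrite /= subr0.
  apply: filterS2 fg0 => h; rewrite /= !fctE /= => ->.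
  by rewrite (nbhs_singleton fg).
have df := diff_unique cdg fE.
by apply/diff_locallyP; rewrite df.
Qed.

(** * Quasiconvexity tested with compactly supported potentials *)

Section periodic_extension.
Context (R : realType) (n : nat) (U V W : innerProductType R) (k l : nat)
  (A : operator n V W k) (B : operator n U V l) (u : 'rV[R]_n -> U)
  (K : set 'rV[R]_n).
Hypotheses (cK : compact K) (Kcube : K `<=` @cube R n).
Hypotheses (l_gt0 : (0 < l)%N) (su : smooth u) (u0 : forall x, ~ K x -> u x = 0).
Hypothesis kerA : forall xi : 'rV[R]_n,
  xi != 0 -> lker (symbol A xi) = limg (symbol B xi).

Let v := apply_operator B u.
Let v0 x : ~ K x -> v x = 0. Proof. exact: apply_operator_off_support. Qed.
Let sv : smooth v. Proof. exact: smooth_apply_operator. Qed.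

Lemma quasiconvex_operator (F : V -> R) (z0 : V) : quasiconvex A F ->
  F z0 <= cube_integral (fun x => F (z0 + v x)).
Proof.
move=> [cF qF]; pose w := periodization v.
(* Smoothness of [w] and the equation [A w = 0] are local, so both are inherited from translates of
   [v]. *)
have wv (x : 'rV[R]_n) : \forall y \near x, w y = v (y - \row_i (Num.floor (x 0 i))%:~R).
  by apply: (periodization_near cK Kcube); exact: v0.
have cube_w (f : V -> R) : cube_integral (fun x => f (w x)) = cube_integral (fun x => f (v x)).
  apply: eq_Rintegral => t; rewrite inE => tc.
  by rewrite /w /periodization fractional_cube.
have -> : cube_integral (fun x => F (z0 + v x)) = cube_integral (fun x => F (z0 + w x)).
  by rewrite (cube_w (fun y => F (z0 + y))).
apply: qF.
- move=> s x; apply: near_eq_differentiable (iterated_near s (wv x)) _.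
  exact: (smooth_translate _ sv s x).
- exact: periodization_periodic.
- rewrite /vector_integral big1// => i _; rewrite cube_w.
  rewrite (cube_integral_operator cK Kcube B l_gt0 su u0 (coord (vbasis {:V}) i)).
  by rewrite scale0r.
- move=> x; rewrite (apply_operator_near _ (wv x)) apply_operator_translate.
  exact: apply_operator_comp_eq0.
Qed.

(** Subtracting [F z0] makes the integrand vanish off [K], which yields integrability over the whole
    space. *)
Lemma increment_integrable (F : V -> R) (z0 : V) : continuous F ->
  (lebesgue_tuple R n).-integrable setT
    (EFin \o ((fun x => F (z0 + v x) - F z0) \o @row_of_tuple R n)).
Proof.
move=> cF; apply: (integrable_support cK Kcube).
  move=> x; apply: (@continuousB _ _ _ (fun x => F (z0 + v x)) (cst (F z0))); last exact: cst_continuous.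
  apply: (@continuous_comp _ _ _ (fun x => z0 + v x) F); last exact: cF.
  by apply: (@continuousD _ _ _ (cst z0) v); [exact: cst_continuous | exact: smooth_continuous].
by move=> x /v0 ->; rewrite addr0 subrr.
Qed.

Lemma quasiconvex_operator_increment (F : V -> R) (z0 : V) : quasiconvex A F ->
  0 <= cube_integral (fun x => F (z0 + v x) - F z0).
Proof.
move=> qF; have cF := qF.1.
have /= mc := @measurable_tcube R n.
have := quasiconvex_operator z0 qF; rewrite -[leLHS]add0r.
have -> : cube_integral (fun x => F (z0 + v x)) =
    cube_integral (fun x => F (z0 + v x) - F z0) + F z0.
  rewrite /cube_integral -[X in _ = _ + X](mulr1).
  have {1}-> : (1 : R) = fine (lebesgue_tuple R n (@tcube R n)).
    by rewrite lebesgue_tcube.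
  rewrite -Rintegral_cst// -RintegralD//.
  - by apply: eq_Rintegral => t _; rewrite /= subrK.
  - by apply: (integrableS measurableT) => //; exact: increment_integrable.
  - apply: (@measurable_bounded_integrable _ _ _ _ (cst (F z0))) => //.
      by rewrite [X in (X < _)%E]lebesgue_tcube ltry.
    exists `|F z0|; split; first exact: num_real.
    by move=> M cM t _ /=; exact: ltW.
by rewrite lerD2r.
Qed.

End periodic_extension.

Section scaling.
Context (R : realType) (n : nat) (U V : innerProductType R) (l : nat)
  (B : operator n U V l) (u : 'rV[R]_n -> U).

Lemma apply_operatorZ (a : R) : smooth u ->
  apply_operator B (fun x => a *: u x) = (fun x => a *: apply_operator B u x).
Proof.
move=> su; apply/funext => x; rewrite /apply_operator scaler_sumr.
apply: eq_bigr => b _; rewrite -linearZ; congr (B b _).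
rewrite !mderivE (@iterated_linear _ _ _ _ (GRing.scale a) u)//.
exact: linear_findim_continuous.
Qed.

Lemma smoothZ (a : R) : smooth u -> smooth (fun x => a *: u x).
Proof.
apply: (@smooth_linear _ _ _ _ (GRing.scale a) u).
exact: linear_findim_continuous.
Qed.

End scaling.

(** * Recession functions *)

Section recession.
Context (R : realType) (V : innerProductType R).

Lemma locally_compact (x : V) : exists2 K : set V, compact K & nbhs x K.
Proof.
pose f (r : 'rV[R]_(\dim {:V})) : V := \sum_i r 0 i *: (vbasis {:V})`_i.
(* [M] bounds every coordinate of a point whose coordinates are within 1 of those of [x]. *)
pose M : R := \sum_i `|coord (vbasis {:V}) i x| + 1.
have fc : continuous f.
  have -> : f = \sum_i (fun r : 'rV[R]_(\dim {:V}) => r 0 i *: (vbasis {:V})`_i).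
    by apply/funext => r; rewrite fct_sumE.
  move=> r; apply: differentiable_continuous; apply: differentiable_sum => i.
  exact/differentiableZl/differentiable_coord.
exists (f @` [set r : 'rV[R]_(\dim {:V}) | forall i, r 0 i \in `[- M, M]]).
  apply: continuous_compact; first exact: continuous_subspaceT.
  apply: (@rV_compact _ _ (fun=> `[- M, M]%classic)) => i.
  exact: segment_compact.
have : \forall y \near x, forall i, `|coord (vbasis {:V}) i x - coord (vbasis {:V}) i y| < 1.
  apply: filter_forall => i.
  by have /cvgrPdist_lt := (@basis_coord_continuous _ V i x); apply.
apply: filterS => y xy; exists (\row_i coord (vbasis {:V}) i y).
  move=> i; rewrite mxE in_itv/= -ler_norml /M.
  rewrite (bigD1 i)//= -[X in `|X|](subKr (coord (vbasis {:V}) i x)).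
  rewrite (le_trans (ler_normB _ _))// -addrA lerD2l addrC.
  by rewrite (le_trans (ltW (xy i)))// lerDl sumr_ge0.
rewrite /f {2}(coord_vbasis (memvf y)).
by apply: eq_bigr => i _; rewrite mxE.
Qed.

Definition recession_cvg (Phi g : V -> R) := forall K : set V, compact K ->
  forall e, 0 < e -> \forall t \near +oo, forall z, K z -> `|g z - Phi (t *: z) / t| < e.

Lemma recession_cvgP (Phi g : V -> R) :
  {family compact, (fun z => Phi (t *: z) / t) @[t --> +oo] --> g} <->
  recession_cvg Phi g.
Proof.
split=> [/fam_cvgP Pg K cK e e0|Pg].
  apply: (Pg K cK [set h | forall z, K z -> `|g z - h z| < e]).
  apply/uniform_nbhs; exists [set uv | `|uv.1 - uv.2| < e]; split => //.
  by rewrite -entourage_ballE; exists e.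
apply/fam_cvgP => K cK P /uniform_nbhs[E [entE EP]].
move: entE; rewrite -entourage_ballE => -[e /= e0 eE].
have := Pg K cK e e0; apply: filterS => t zt; apply: EP => z Kz; apply: eE.
by rewrite /=; exact: zt.
Qed.

Lemma recession_cvg_lim (Phi g : V -> R) : recession_cvg Phi g -> recession Phi = g.
Proof.
move=> Pg; apply/funext => z; apply: cvg_lim => //; apply/cvgrPdist_lt => e e0.
have := Pg [set z] (@compact_set1 _ z) e e0; apply: filterS => t; exact.
Qed.

Lemma in_H_intro (Phi g : V -> R) (c : R) : continuous Phi ->
  (forall z, `|Phi z| <= c * (1 + `|z|)) -> recession_cvg Phi g ->
  in_H Phi /\ recession Phi = g.
Proof.
move=> cPhi PhiC Pg; have rg := recession_cvg_lim Pg; split => //.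
by split => //; [exists c | rewrite rg; apply/recession_cvgP].
Qed.

Lemma recession_cvg_homogeneous (Phi : V -> R) :
  (forall t z, 0 < t -> Phi (t *: z) = t * Phi z) -> recession_cvg Phi Phi.
Proof.
move=> hPhi K _ e e0; near=> t => z _.
have t0 : 0 < t by near: t; exact: nbhs_pinfty_gt.
by rewrite hPhi// mulrC mulKf ?gt_eqF// subrr normr0.
Unshelve. all: by end_near. Qed.

Lemma in_H_norm : in_H (fun z : V => `|z|).
Proof.
have [] // := @in_H_intro (fun z => `|z|) (fun z => `|z|) 1.
- exact: norm_continuous.
- by move=> z; rewrite normr_id mul1r lerDr.
- by apply: recession_cvg_homogeneous => t z t0; rewrite normrZ gtr0_norm.
Qed.

Lemma in_H_linear (L : {linear V -> R^o}) : in_H L /\ recession L = L.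
Proof.
have cL : continuous L by exact: linear_findim_continuous.
have /linear_boundedP/pinfty_ex_gt0[M M0 LM] := continuous_linear_bounded 0 (cL 0).
apply: (@in_H_intro L L M) => //.
  by move=> z; apply: le_trans (LM z) _; apply: ler_wpM2l; [exact: ltW | rewrite lerDr].
by apply: recession_cvg_homogeneous => t z t0; rewrite linearZ.
Qed.

(** A locally uniform limit of continuous functions: one [t] that is good on a compact neighbourhood
    of [x] gives the three-term estimate. *)
Lemma recession_continuous (Phi : V -> R) : in_H Phi -> continuous (recession Phi).
Proof.
move=> [cPhi _ /recession_cvgP Pg] x; apply/cvgrPdist_lt => e e0.
have [K cK Kx] := locally_compact x.
have e3 : 0 < e / 3 by rewrite divr_gt0.
have Kxx := nbhs_singleton Kx.
have [t tK] := filter_ex (Pg K cK _ e3).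
have : \forall y \near x, `|Phi (t *: x) / t - Phi (t *: y) / t| < e / 3.
  have /cvgrPdist_lt : (fun y => Phi (t *: y) / t) @ x --> Phi (t *: x) / t; last exact.
  apply: cvgMr_tmp; apply: (@continuous_comp _ _ _ (fun y => t *: y) Phi); last exact: cPhi.
  exact: scaler_continuous.
apply: filterS2 Kx => y Ky xy.
have := tK _ Kxx; have := tK _ Ky.
move: xy; move: (recession _ _) (recession _ _) (_ / t) (_ / t) => a b c d.
rewrite !ltr_norml; lra.
Qed.

(** With [s = a * t], the quotient of [Psi] is that of [Phi] at [z + s^-1 *: b], up to [k / s].
    Uniform convergence on a larger compact set and continuity of the recession function absorb the
    vanishing shift. *)
Lemma in_H_affine (Phi : V -> R) (a k : R) (b : V) : 0 < a -> in_H Phi ->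
  let Psi y := a^-1 * (Phi (a *: y + b) - k) in
  in_H Psi /\ recession Psi = recession Phi.
Proof.
move=> a0 HPhi Psi; have rc := recession_continuous HPhi.
have [cPhi [C PhiC] /recession_cvgP Pg] := HPhi.
(* The growth constant comes from [1 + a * |y| + |b| <= (1 + a + |b|) * (1 + |y|)]. *)
apply: (@in_H_intro Psi (recession Phi) (a^-1 * (`|C| * (1 + a + `|b|) + `|k|))).
- move=> y; apply: cvgMl_tmp; apply: (@continuousB _ _ _ (fun y => Phi (a *: y + b)) (cst k)); last exact: cst_continuous.
  apply: (@continuous_comp _ _ _ (fun y => a *: y + b) Phi); last exact: cPhi.
  exact: differentiable_continuous.
- move=> z; rewrite /Psi normrM gtr0_norm ?invr_gt0// -mulrA.
  apply: ler_wpM2l; first by rewrite invr_ge0 ltW.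
  rewrite (le_trans (ler_normB _ _))// mulrDl lerD//; last first.
    by rewrite ler_peMr// lerDl.
  rewrite (le_trans (PhiC _))// (le_trans (ler_wpM2r _ (ler_norm C)))// -mulrA.
  rewrite ler_wpM2l// (@le_trans _ _ (1 + (a * `|z| + `|b|)))//.
    by rewrite lerD2l (le_trans (ler_normD _ _))// normrZ gtr0_norm.
  have := normr_ge0 z; have := normr_ge0 b; nra.
move=> K cK e e0.
pose h (p : R * V) : V := p.2 + p.1 *: b.
have ch : continuous h.
  by move=> p; apply: cvgD; [exact: cvg_snd | apply: cvgZr_tmp; exact: cvg_fst].
(* A compact set that contains [y + s^-1 *: b] for all [y] in [K] and all [s >= 1]. *)
pose K' := h @` (`[0, 1]%classic `*` K).
have cK' : compact K'.
  apply: continuous_compact; first exact: continuous_subspaceT.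
  by apply: compact_setX => //; exact: segment_compact.
have e3 : 0 < e / 3 by rewrite divr_gt0.
have near_rec : \forall s \near +oo, forall y, K y ->
    `|recession Phi y - recession Phi (y + s^-1 *: b)| < e / 3.
  (* Compactness of [K] turns continuity at each point into an estimate uniform over [K]. *)
  move/compact_near_coveringP: (cK); apply => x Kx.
  have e6 : 0 < e / 6 by rewrite divr_gt0.
  have /cvgrPdist_lt/(_ _ e6)/nbhs_ballP[r /= r0 xr] := rc x.
  have r2 : 0 < r / 2 by rewrite divr_gt0.
  near=> y s.
  have s0 : 0 < s by near: s; exact: nbhs_pinfty_gt.
  have xy : ball x (r / 2) y by near: y; exact: nbhsx_ballx.
  have sb : `|s^-1 *: b| < r / 2.
    rewrite normrZ gtr0_norm ?invr_gt0// mulrC ltr_pdivrMr//.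
    by rewrite -ltr_pdivrMl//; near: s; apply: nbhs_pinfty_gt; exact: num_real.
  have H1 : `|recession Phi x - recession Phi y| < e / 6.
    by apply: xr; apply: le_ball xy; clear -r0; lra.
  have H2 : `|recession Phi x - recession Phi (y + s^-1 *: b)| < e / 6.
    apply: xr; rewrite (splitr r); apply: ball_triangle xy _.
    by rewrite -ball_normE /ball_/= opprD addNKr normrN.
  move: H1 H2; move: (recession _ x) (recession _ y) (recession _ (y + _)) => p q w.
  rewrite !ltr_norml; lra.
have main : \forall s \near +oo, forall y, K y ->
    `|recession Phi y - (Phi (s *: y + b) - k) / s| < e.
  near=> s => y Ky.
  have s1 : 1 <= s by near: s; exact: nbhs_pinfty_ge.
  have s0 : 0 < s by rewrite (lt_le_trans _ s1).
  have H1 : `|recession Phi y - recession Phi (y + s^-1 *: b)| < e / 3.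
    by move: y Ky; near: s.
  have H2 : `|recession Phi (y + s^-1 *: b) - Phi (s *: (y + s^-1 *: b)) / s| < e / 3.
    have : K' (y + s^-1 *: b).
      by exists (s^-1, y) => //; split => //=; rewrite in_itv/= invr_ge0 ltW//= invf_le1.
    by move: (y + s^-1 *: b); near: s; exact: Pg.
  have H3 : `|k / s| < e / 3.
    rewrite normrM (gtr0_norm (_ : 0 < s^-1)) ?invr_gt0// ltr_pdivrMr//.
    rewrite -ltr_pdivrMl//; near: s; apply: nbhs_pinfty_gt; exact: num_real.
  move: H1 H2 H3; rewrite scalerDr scalerA divff ?gt_eqF// scale1r mulrBl.
  move: (recession _ _) (recession _ _) (_ / s) (_ / s) => p q r v.
  rewrite !ltr_norml; lra.
have main' : \forall t \near +oo, forall y, K y ->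
    `|recession Phi y - (Phi ((a * t) *: y + b) - k) / (a * t)| < e.
  case: main => M [Mr HM]; exists (a^-1 * M); split; first exact: num_real.
  by move=> t Mt; apply: HM; rewrite -ltr_pdivrMl.
near=> t => z Kz.
have t0 : 0 < t by near: t; exact: nbhs_pinfty_gt.
have : forall y, K y -> `|recession Phi y - (Phi ((a * t) *: y + b) - k) / (a * t)| < e.
  by near: t.
move=> /(_ z Kz); rewrite /Psi scalerA invfM.
by rewrite mulrCA mulrA [a^-1 * _]mulrC.
Unshelve. all: by end_near. Qed.

End recession.

(** * Integrals on the sphere and difference quotients *)

Section borel_integrals.
Context (R : realType) (V : innerProductType R).
Implicit Type mu : {measure set (borel V) -> \bar R}.

Lemma continuous_borel_measurable (f : V -> R) : continuous f ->
  measurable_fun [set: borel V] f.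
Proof.
move=> /continuousP cf; apply: (measurability _ (RGenOpens.measurableE R)).
move=> _ [_ [a [b ->] <-]]; rewrite setTI.
by apply: sub_sigma_algebra; apply: cf; exact: interval_open.
Qed.

Lemma measurable_sphere : measurable (@sphere R V : set (borel V)).
Proof.
have mn : measurable_fun [set: borel V] (fun y : V => `|y|).
  by apply: continuous_borel_measurable; exact: norm_continuous.
have -> : @sphere R V = [set: borel V] `&` (fun y : V => `|y|) @^-1` [set 1].
  by rewrite setTI.
by apply: mn => //; exact: measurable_set1.
Qed.

Lemma sphere_integrable mu (f : V -> R) (C : R) : (mu setT < +oo)%E ->
  continuous f -> (forall y, `|y| = 1 -> `|f y| <= C) ->
  mu.-integrable (@sphere R V) (EFin \o f).
Proof.
move=> muT cf fC; apply: measurable_bounded_integrable.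
- exact: measurable_sphere.
- apply: le_lt_trans muT; apply: le_measure; rewrite ?inE//; exact: measurable_sphere.
- by apply: measurable_funTS; exact: continuous_borel_measurable.
- exists C; split; first exact: num_real.
  by move=> M CM y y1; apply: le_trans (fC y y1) (ltW CM).
Qed.

Lemma sphere_integral_mscale mu (t : {nonneg R}) (f : V -> R) :
  mu.-integrable (@sphere R V) (EFin \o f) ->
  sphere_integral (mscale t mu) f = t%:num * sphere_integral mu f.
Proof.
move=> intf; have mS := measurable_sphere.
have mf : measurable_fun (@sphere R V : set (borel V)) (EFin \o f).
  by case/integrableP : intf.
rewrite /sphere_integral /Rintegral -[t%:num in RHS]/(fine t%:num%:E) -fineM//; last first.
  exact: integrable_fin_num.
congr fine; rewrite integralE [in RHS]integralE.
rewrite !ge0_integral_mscale//; [|exact: measurable_funeneg|exact: measurable_funepos].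
apply/esym/muleBr => //; apply: fin_num_adde_defr.
exact: (integrable_pos_fin_num mS intf).
Qed.

Lemma linear_sphere_integrable mu (L : {linear V -> R^o}) : (mu setT < +oo)%E ->
  mu.-integrable (@sphere R V) (EFin \o L).
Proof.
move=> muT; have cL : continuous L by exact: linear_findim_continuous.
have /linear_boundedP/pinfty_ex_gt0[M M0 LM] := continuous_linear_bounded 0 (cL 0).
by apply: (sphere_integrable muT cL (C := M)) => y y1; rewrite (le_trans (LM y))// y1 mulr1.
Qed.

Lemma Rintegral_sum d (T : measurableType d) (mu : {measure set T -> \bar R})
    (D : set T) (I : Type) (s : seq I) (f : I -> T -> R) : measurable D ->
  (forall i, mu.-integrable D (EFin \o f i)) ->
  \int[mu]_(x in D) (\sum_(i <- s) f i x) = \sum_(i <- s) \int[mu]_(x in D) f i x.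
Proof.
move=> mD fi; elim: s => [|i s IH].
  under eq_Rintegral do rewrite big_nil.
  by rewrite big_nil /Rintegral integral0.
under eq_Rintegral do rewrite big_cons.
rewrite big_cons RintegralD ?IH//.
have -> : EFin \o (fun x => \sum_(j <- s) f j x) =
    (fun x => \sum_(j <- s) (EFin \o f j) x)%E.
  by apply/funext => x; rewrite /= sumEFin.
exact: integrable_sum.
Qed.

Lemma linear_barycentre mu (L : {linear V -> R^o}) : (mu setT < +oo)%E ->
  L (barycentre mu) = sphere_integral mu L.
Proof.
move=> muT; have mS := measurable_sphere.
pose c i : {linear V -> R^o} := coord (vbasis {:V}) i.
have ci i : mu.-integrable (@sphere R V) (EFin \o c i) by exact: linear_sphere_integrable.
rewrite /barycentre /vector_integral linear_sum.
have -> : sphere_integral mu L =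
    \int[mu]_(y in @sphere R V) (\sum_(i < \dim {:V}) c i y * L (vbasis {:V})`_i).
  apply: eq_Rintegral => y _; rewrite {1}(coord_vbasis (memvf y)) linear_sum.
  by apply: eq_bigr => i _; rewrite linearZ.
rewrite (@Rintegral_sum _ _ mu (@sphere R V) _ _ (fun i y => c i y * L (vbasis {:V})`_i))//.
  by apply: eq_bigr => i _; rewrite linearZ/=; apply/esym; apply: RintegralZr => //; exact: ci.
move=> i; have -> : EFin \o (fun y => c i y * L (vbasis {:V})`_i) =
    (fun y => (EFin \o c i) y * (L (vbasis {:V})`_i)%:E)%E.
  by apply/funext => y; rewrite /= EFinM.
exact: integrableZr.
Qed.

Lemma recession_sphere_bounded (F : V -> R) : in_H F ->
  exists C, forall y, `|y| = 1 -> `|recession F y| <= C.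
Proof.
(* The 1 is the distance to a quotient at some [t >= 1]; the 2 bounds [(1 + t) / t]. *)
move=> [_ [C FC] /recession_cvgP Fr]; exists (1 + `|C| * 2) => y y1.
have [t [/(_ y erefl) ty t1]] := filter_ex (filterI (Fr [set y] (@compact_set1 _ y) 1 ltr01)
  (nbhs_pinfty_ge (num_real (1 : R)))).
have t0 : 0 < t by rewrite (lt_le_trans _ t1).
rewrite -[X in `|X|](subrK (F (t *: y) / t)).
apply: le_trans (ler_normD _ _) _; apply: lerD; first exact: ltW.
rewrite normrM normfV (gtr0_norm t0) ler_pdivrMr// (le_trans (FC _))//.
rewrite (le_trans (ler_wpM2r _ (ler_norm C)))// -mulrA ler_wpM2l//.
by rewrite normrZ y1 mulr1 gtr0_norm//; lra.
Qed.

Lemma increment_lipschitz (F : V -> R) (z0 : V) (C : R) :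
  (forall z, `|F z| <= C * (1 + `|z|)) -> differentiable F z0 ->
  exists M, forall h, `|F (z0 + h) - F z0| <= M * `|h|.
Proof.
move=> FC dF; have cd : continuous ('d F z0) by exact: diff_continuous.
have /linear_boundedP/pinfty_ex_gt0[M M0 LM] := continuous_linear_bounded 0 (cd 0).
have /eqaddoP/(_ 1 ltr01)/nbhs_ballP[r /= r0 rF] := diff_locally dF.
(* For [|h| < r] the derivative contributes [M] and the remainder 1; for [|h| >= r] linear growth
   applies, and constants are at most their quotient by [r] times [|h|]. *)
exists (M + 1 + (`|C| * (1 + `|z0|) + `|F z0|) / r + `|C|) => h.
have c0 : 0 <= (`|C| * (1 + `|z0|) + `|F z0|) / r.
  by rewrite divr_ge0 ?(ltW r0)// addr_ge0// mulr_ge0// addr_ge0.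
have [hr|rh] := ltP `|h| r.
  have Fh : `|F (h + z0) - (F z0 + 'd F z0 h)| <= 1 * `|h|.
    by apply: rF; rewrite -ball_normE /ball_/= sub0r normrN.
  rewrite mul1r (addrC h) in Fh.
  rewrite (@le_trans _ _ ((M + 1) * `|h|))//; last first.
    by rewrite ler_wpM2r// -addrA lerDl addr_ge0.
  have := LM h; move: Fh.
  have -> : F (z0 + h) - F z0 = F (z0 + h) - (F z0 + 'd F z0 h) + 'd F z0 h by ring.
  move=> H1 H2; apply: le_trans (ler_normD _ _) _.
  by rewrite mulrDl mul1r [leRHS]addrC; exact: lerD.
rewrite (@le_trans _ _ (((`|C| * (1 + `|z0|) + `|F z0|) / r + `|C|) * `|h|))//; last first.
  by rewrite ler_wpM2r// lerD2r lerDr addr_ge0// ltW.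
rewrite (le_trans (ler_normB _ _))//.
apply: (@le_trans _ _ (`|C| * (1 + (`|z0| + `|h|)) + `|F z0|)).
  rewrite lerD2r (le_trans (FC _))// (le_trans (ler_wpM2r _ (ler_norm C)))//.
  by rewrite ler_wpM2l// lerD2l ler_normD.
have -> : `|C| * (1 + (`|z0| + `|h|)) + `|F z0| = (`|C| * (1 + `|z0|) + `|F z0|) + `|C| * `|h| by ring.
rewrite mulrDl lerD2r -mulrA ler_peMr//.
by rewrite ler_pdivlMl// mulr1.
Qed.

Lemma difference_quotient_cvg (F : V -> R) (z0 y : V) : differentiable F z0 ->
  (k.+1%:R * (F (z0 + k.+1%:R^-1 *: y) - F z0)) @[k --> \oo] --> ('d F z0 y : R).
Proof.
move=> dF; rewrite -deriveE//.
have /= dy : h^-1 *: (F (h *: y + z0) - F z0) @[h --> 0^'] --> 'D_y F z0.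
  exact: diff_derivable dF.
have h0 : (k.+1%:R^-1 : R) @[k --> \oo] --> 0^'.
  move=> P P0; have {}P0 : nbhs (0 : R) (fun h => h != 0 -> P h) by [].
  have [N _ NP] := cvg_harmonic P0; exists N => // k /NP; apply.
  by rewrite invr_eq0 pnatr_eq0.
have := cvg_comp _ _ h0 dy; apply: cvg_trans; apply: near_eq_cvg.
by near=> k; rewrite /= invrK (addrC z0).
Unshelve. all: by end_near. Qed.

End borel_integrals.

(** * Passage to the limit in [Y_z] *)

Section main.
Context (R : realType) (n : nat) (U V W : innerProductType R) (k l : nat)
  (A : operator n V W k) (B : operator n U V l) (z : V)
  (nu0 muoo : {measure set (borel V) -> \bar R}).
Hypothesis l_gt0 : (0 < l)%N.
Hypothesis kerA : forall xi : 'rV[R]_n, xi != 0 -> lker (symbol A xi) = limg (symbol B xi).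
Hypothesis nuY : in_Y B z nu0 muoo.

(** The integrand is an affine reparametrisation of [F] with shift [z0 - a *: z], hence an
    admissible test function with the recession function of [F]; its cube integrals are nonnegative
    for every [j]. *)
Lemma in_Y_increment (F : V -> R) (a : R) (z0 : V) : 0 < a -> in_H F ->
  quasiconvex A F ->
  nu0.-integrable setT (EFin \o (fun y => a^-1 * (F (z0 + a *: (y - z)) - F z0))) /\
  0 <= \int[nu0]_y (a^-1 * (F (z0 + a *: (y - z)) - F z0)) +
       sphere_integral muoo (recession F).
Proof.
move=> a0 HF qF.
have [HG rG] := in_H_affine (F z0) (z0 - a *: z) a0 HF.
have GE y : F (a *: y + (z0 - a *: z)) = F (z0 + a *: (y - z)).
  by rewrite addrCA scalerBr.
have {GE}GE : (fun y => a^-1 * (F (a *: y + (z0 - a *: z)) - F z0)) =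
    (fun y => a^-1 * (F (z0 + a *: (y - z)) - F z0)).
  by apply/funext => y; rewrite GE.
rewrite GE in HG rG; have [_ _ _ [u [su _ uY]]] := nuY.
have [iG cG] := uY _ HG; split => //; rewrite rG in cG.
rewrite -(cvg_lim _ cG)//; apply: limr_ge.
  by apply/cvg_ex; eexists; exact: cG.
apply: nearW => j; have [suj cK Kc] := su j.
have uj0 x : ~ closure [set x | u j x != 0] x -> a *: u j x = 0.
  move=> nx; apply/eqP; rewrite scaler_eq0; apply/orP; right; apply/negPn/negP => ux.
  by apply: nx; apply: subset_closure.
have := quasiconvex_operator_increment cK Kc l_gt0 (smoothZ a suj) uj0 kerA z0 qF.
have intf := increment_integrable B cK Kc (smoothZ a suj) uj0 z0 qF.1.
rewrite apply_operatorZ// in intf *; move=> Fu.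
rewrite /cube_integral.
under eq_Rintegral do rewrite addrAC subrr add0r.
rewrite RintegralZl; first by rewrite mulr_ge0// invr_ge0 ltW.
  exact: measurable_tcube.
apply: (integrableS measurableT) => //; exact: measurable_tcube.
Qed.

(** Since [B u_j] has mean zero, the cube integral of [L] equals [L z] for every [j], so the limit
    in [Y_z] is that of a constant sequence. *)
Lemma in_Y_linear (L : {linear V -> R^o}) :
  nu0.-integrable setT (EFin \o L) /\
  L z = \int[nu0]_y L y + sphere_integral muoo L.
Proof.
have [HL rL] := in_H_linear L; have [_ _ _ [u [su _ uY]]] := nuY.
have [iL cL] := uY _ HL; split => //; rewrite rL in cL.
rewrite -(cvg_lim _ cL)//; apply/esym/cvg_lim => //.
apply: cvg_near_cst; apply: nearW => j; have [suj cK Kc] := su j.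
apply: (cube_integral_add_operator cK Kc B l_gt0 suj) => x nx.
by apply/eqP/negPn/negP => ux; apply: nx; apply: subset_closure.
Qed.

Lemma in_Y_gradient (F : V -> R) (z0 : V) : in_H F -> quasiconvex A F ->
  differentiable F z0 ->
  sphere_integral muoo ('d F z0) <= sphere_integral muoo (recession F).
Proof.
move=> HF qF dF; have [cF [C FC] _] := HF.
have [M FM] := increment_lipschitz FC dF.
pose L : {linear V -> R^o} := 'd F z0.
have [iL Lz] := in_Y_linear L.
pose h (m : nat) : R := m.+1%:R^-1.
have h0 m : 0 < h m by rewrite invr_gt0.
pose G m y := (h m)^-1 * (F (z0 + h m *: (y - z)) - F z0).
have iG m : nu0.-integrable setT (EFin \o G m) by exact: (in_Y_increment z0 (h0 m) HF qF).1.
have G0 m : 0 <= \int[nu0]_y G m y + sphere_integral muoo (recession F).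
  exact: (in_Y_increment z0 (h0 m) HF qF).2.
pose N (y : V) : R := `|y - z|.
(* The first moment of [nu0] is finite because [y -> |y - z|] is itself an admissible test
   function. *)
have inorm : nu0.-integrable setT (fun y => M%:E * (EFin \o N) y)%E.
  apply: integrableZl => //; have [Hn _] := in_H_affine 0 (- z) ltr01 (in_H_norm V).
  have [_ _ _ [u [_ _ uY]]] := nuY; have [+ _] := uY _ Hn.
  by congr (nu0.-integrable setT _); apply/funext => y; rewrite /= scale1r invr1 mul1r subr0.
have [nu01 _ _ _] := nuY.
have icst : nu0.-integrable setT (EFin \o cst (L z)).
  apply: measurable_bounded_integrable => //; first by rewrite nu01 ltry.
  exists `|L z|; split; first exact: num_real.
  by move=> x cx t _ /=; exact: ltW.
pose Lz' (y : V) : R := L (y - z).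
have Lz'E : EFin \o Lz' = ((EFin \o L) \- (EFin \o cst (L z)))%E.
  by apply/funext => y; rewrite /Lz' /= linearB.
have iLz' : nu0.-integrable setT (EFin \o Lz') by rewrite Lz'E; exact: integrableB.
have intLz' : \int[nu0]_y Lz' y = \int[nu0]_y L y - L z.
  have Lz1 : \int[nu0]_y cst (L z) y = L z by rewrite Rintegral_cst// nu01 mulr1.
  rewrite -[X in _ - X]Lz1 -RintegralB//.
  by apply: eq_Rintegral => y _; rewrite /Lz' linearB.
have mE (f : V -> R) : nu0.-integrable setT (EFin \o f) ->
   measurable_fun [set: borel V] (EFin \o f).
  by case/integrableP.
have Gcvg : {ae nu0, forall y, setT y -> (EFin \o G m) y @[m --> \oo] --> (EFin \o Lz') y}.
  apply: aeW => y _; apply/cvg_EFin; first exact: nearW.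
  rewrite /comp/= /G /h; under eq_fun do rewrite invrK.
  exact: difference_quotient_cvg.
have Gdom : {ae nu0, forall y m, setT y -> (`|(EFin \o G m) y| <= M%:E * (EFin \o N) y)%E}.
  apply: aeW => y m _; rewrite /= lee_fin /G normrM gtr0_norm ?invr_gt0//.
  by rewrite ler_pdivrMl// (le_trans (FM _))// normrZ (gtr0_norm (h0 m)) mulrCA.
have [_ _ intG] := @dominated_convergence _ _ _ nu0 setT measurableT
  (fun m => EFin \o G m) (EFin \o Lz') _ (fun m => mE _ (iG m)) (mE _ iLz') Gcvg inorm Gdom.
have {}intG : \int[nu0]_y G m y @[m --> \oo] --> \int[nu0]_y Lz' y.
  apply: fine_cvg; rewrite fineK; first exact: intG.
  exact: integrable_fin_num.
have lim0 : 0 <= \int[nu0]_y Lz' y + sphere_integral muoo (recession F).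
  have cG : \int[nu0]_y G m y + sphere_integral muoo (recession F) @[m --> \oo] -->
      \int[nu0]_y Lz' y + sphere_integral muoo (recession F).
    by apply: cvgD intG _; exact: cvg_cst.
  rewrite -(cvg_lim _ cG)//; apply: limr_ge.
    by apply/cvg_ex; eexists; exact: cG.
  by apply: nearW => m; exact: G0.
(* By [in_Y_linear] the limit integral over [nu0] is minus the sphere integral of [L], which moves
   to the other side. *)
move: lim0; rewrite intLz' Lz opprD addNKr => lim0.
by rewrite -subr_ge0 addrC.
Qed.
End main.

Theorem mainTheorem3 (R : realType) (n : nat) (U V W : innerProductType R)
    (k l : nat) (A : operator n V W k) (B : operator n U V l)
    (z : V) (nu0 nuoo : probability (borel V) R) (t : R) (F : V -> R)
    (n_gt0 : (0 < n)%N) (l_gt0 : (0 < l)%N) (t_gt0 : 0 < t) :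
  constant_rank A ->
  spanning_wave_cone A ->
  (forall xi : 'rV[R]_n, xi != 0 -> lker (symbol A xi) = limg (symbol B xi)) ->
  nuoo (~` @sphere R V) = 0%E ->
  in_Y B z nu0 (mscale (NngNum (ltW t_gt0)) nuoo) ->
  in_H F -> quasiconvex A F ->
  (gradient_sup F (barycentre nuoo)
     <= (sphere_integral nuoo (recession F))%:E)%E.
Proof.
move=> _ _ kerA _ nuY HF qF; apply: ge_ereal_sup => _ [z0 dF <-].
have nuT : (nuoo setT < +oo)%E by rewrite probability_setT ltry.
have [C FC] := recession_sphere_bounded HF.
have iF := sphere_integrable nuT (recession_continuous HF) FC.
have := in_Y_gradient l_gt0 kerA nuY HF qF dF.
(* Both sides carry the factor [t > 0], which cancels; the remaining left integral is the
   differential at the barycentre. *)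
rewrite (sphere_integral_mscale _ (linear_sphere_integrable ('d F z0) nuT)).
rewrite (sphere_integral_mscale _ iF) ler_pM2l//.
by rewrite -linear_barycentre// lee_fin.
Qed.
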